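(* Let $S$ be a separable self-adjoint operator space that generates a nonunital $C^*$-algebra $A$, let $\tilde A=A+\mathbb C\cdot\mathbf 1$, $\tilde S=S+\mathbb C\cdot\mathbf 1$, and let $\pi_\infty:\tilde A\to\mathbb C$ be the representation at $\infty$, $\pi_\infty(a+\lambda\cdot\mathbf 1)=\lambda$ for $a\in A$, $\lambda\in\mathbb C$. The following are equivalent: (i) $\pi_\infty$ is a boundary representation for $\tilde S$. (ii) $A$ contains a strictly positive operator that is almost dominated by $S$. (iii) Every self-adjoint operator $x\in A$ is almost dominated by $S$.
   Context: A self-adjoint operator space is a linear subspace $S=S^*$ of a $C^*$-algebra (operators on a Hilbert space), and the $C^*$-algebra it generates is the smallest norm-closed $*$-subalgebra containing it. $\tilde A$ is $A$ with the identity operator $\mathbf 1$ adjoined. A self-adjoint $x\in A$ is almost dominated by $S$ if there is a sequence of self-adjoint operators $s_n\in S$ such that $s_n+\frac1n\cdot\mathbf 1\ge x$ for $n=1,2,\dots$. A positive $p\in A$ is strictly positive if for every positive linear functional $\phi$ on $A$, $\phi(p)=0\implies\phi=0$. An operator system is a self-adjoint linear subspace $T$ of a unital $C^*$-algebra containing the unit, and $C^*(T)$ is the $C^*$-algebra it generates. UCP means unital completely positive. A UCP map $\phi:T\to B$ into a unital $C^*$-algebra has the unique extension property if it has a unique UCP extension $C^*(T)\to B$ and moreover this extension is multiplicative. A boundary representation for $T$ is an irreducible representation $\pi$ of $C^*(T)$ such that $\pi\restriction_T$ has the unique extension property. *)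

(* Defs.v *)
From HB Require Import structures.
From mathcomp Require Import all_boot all_order all_algebra.
From mathcomp Require Import sesquilinear complex.
From mathcomp Require Import all_classical all_reals all_analysis.

Set Implicit Arguments.
Unset Strict Implicit.
Unset Printing Implicit Defensive.

Import Order.TTheory GRing.Theory Num.Theory.
Import numFieldNormedType.Exports.

Local Open Scope classical_set_scope.
Local Open Scope ring_scope.
Local Open Scope complex_scope.

(* The inner product is linear in its first argument. *)
HB.mixin Record isHilbert (R : realType) (H : Type)
    of CompleteNormedModule R[i] H := {
  hdot : {dot H for Num.conj} ;
  hdot_norm : forall x : H, `|x| ^+ 2 = hdot x x
}.

#[short(type="hilbertType")]
HB.structure Definition Hilbert (R : realType) :=
  { H of isHilbert R H & CompleteNormedModule R[i] H }.

Notation "''<' x , y >" := (hdot x y)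
  (at level 2, x at level 69, y at level 69, format "''<' x ,  y >") : ring_scope.

Definition bounded_op (R : realType) (H : hilbertType R) : pred (H -> H) :=
  [pred f | `[< linear f /\ continuous f >]].

Record bop (R : realType) (H : hilbertType R) := Bop {
  bop_fun :> H -> H ;
  bop_funP : bounded_op bop_fun
}.

HB.instance Definition _ R H := [isSub for @bop_fun R H].
HB.instance Definition _ R H := [Choice of @bop R H by <:].

Section BoundedOperators.
Variables (R : realType) (H : hilbertType R).
Implicit Types (f g : bop H) (x y : H) (a : R[i]).

Lemma bop_linear f : linear f.
Proof. by have /asboolP[] := bop_funP f. Qed.

Lemma bop_continuous f : continuous f.
Proof. by have /asboolP[] := bop_funP f. Qed.

HB.instance Definition _ f := GRing.isLinear.Build R[i] H H *:%R f (bop_linear f).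

Lemma bop_ext f g : f =1 g -> f = g.
Proof. by move=> fg; apply: val_inj; apply/funext. Qed.

Lemma bounded_op_submod : subsemimod_closed (@bounded_op R H).
Proof.
split; first split.
- apply/asboolP; split=> [a x y|x]; first by rewrite /= scaler0 addr0.
  exact: cvg_cst.
- move=> f g /asboolP[fl fc] /asboolP[gl gc]; apply/asboolP; split.
    move=> a x y; change (f (a *: x + y) + g (a *: x + y) =
      a *: (f x + g x) + (f y + g y)).
    by rewrite fl gl scalerDr addrACA.
  by move=> x; apply: cvgD; [exact: fc|exact: gc].
- move=> a f /asboolP[fl fc]; apply/asboolP; split.
    move=> b x y; change (a *: f (b *: x + y) = b *: (a *: f x) + a *: f y).
    by rewrite fl scalerDr !scalerA mulrC.
  by move=> x; apply: cvgZr; exact: fc.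
Qed.

HB.instance Definition _ :=
  GRing.SubChoice_isSubLmodule.Build R[i] (H -> H) (@bounded_op R H) (bop H)
    bounded_op_submod.

Lemma bopD f g x : (f + g) x = f x + g x. Proof. by []. Qed.
Lemma bopZ a f x : (a *: f) x = a *: f x. Proof. by []. Qed.
Lemma bop0 x : (0 : bop H) x = 0. Proof. by []. Qed.
Lemma bopN f x : (- f) x = - f x. Proof. by []. Qed.

Lemma bop_id_subproof : bounded_op (@idfun H).
Proof. by apply/asboolP; split=> // x; exact: cvg_id. Qed.

Lemma bop_comp_subproof f g : bounded_op (f \o g).
Proof.
apply/asboolP; split=> [a x y|x]; first by rewrite /= !linearP.
exact: continuous_comp (@bop_continuous g x) (@bop_continuous f (g x)).
Qed.

Definition bop_id : bop H := Bop bop_id_subproof.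
Definition bop_comp f g : bop H := Bop (bop_comp_subproof f g).

Lemma bop_compA : associative bop_comp. Proof. by move=> f g h; apply: bop_ext. Qed.
Lemma bop_comp1l : left_id bop_id bop_comp. Proof. by move=> f; apply: bop_ext. Qed.
Lemma bop_comp1r : right_id bop_id bop_comp. Proof. by move=> f; apply: bop_ext. Qed.
Lemma bop_compDl : left_distributive bop_comp +%R.
Proof. by move=> f g h; apply: bop_ext. Qed.
Lemma bop_compDr : right_distributive bop_comp +%R.
Proof. by move=> f g h; apply: bop_ext => x; exact: linearD. Qed.

HB.instance Definition _ := GRing.Zmodule_isPzRing.Build (bop H)
  bop_compA bop_comp1l bop_comp1r bop_compDl bop_compDr.

Lemma bopM f g x : (f * g) x = f (g x). Proof. by []. Qed.
Lemma bop1 x : (1 : bop H) x = x. Proof. by []. Qed.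

Definition scalar_op a : bop H := a *: (1 : bop H).

End BoundedOperators.

Arguments scalar_op {R H} a.

Section OperatorNorm.
Variables (R : realType) (H : hilbertType R).
Implicit Types (f g : bop H) (x y : H) (a : R[i]).

Let Re_le (u v : R[i]) : u <= v -> complex.Re u <= complex.Re v.
Proof. by rewrite lecE => /andP[]. Qed.

Let Re_norm x : (complex.Re `|x|)%:C = `|x| :> R[i].
Proof. by rewrite RRe_real ?normr_real. Qed.

Definition opnorm f : R :=
  sup [set complex.Re `|f x| | x in [set x : H | `|x| <= 1]].

Let opset_has_sup f :
  has_sup [set complex.Re `|f x| | x in [set x : H | `|x| <= 1]].
Proof.
split; first by exists (complex.Re `|f 0|), 0 => //=; rewrite normr0.
have := continuous_linear_bounded 0 (@bop_continuous _ _ f 0).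
move=> /linear_boundedP/pinfty_ex_gt0[r r0 fr].
exists (complex.Re r) => _ [x /= x1 <-]; apply: Re_le.
by rewrite (le_trans (fr x))// ler_piMr// ltW.
Qed.

Lemma le_opnorm f x : `|f x| <= (opnorm f)%:C * `|x|.
Proof.
have [->|x0] := eqVneq x 0; first by rewrite linear0 !normr0 mulr0.
have nx : 0 < `|x| by rewrite normr_gt0.
rewrite -ler_pdivrMr// mulrC.
have -> : `|x|^-1 * `|f x| = `|f (`|x|^-1 *: x)|.
  by rewrite linearZ/= normrZ ger0_norm// invr_ge0 ltW.
rewrite -Re_norm lecR; apply: (ub_le_sup (opset_has_sup f).2).
exists (`|x|^-1 *: x) => //=.
by rewrite normrZ ger0_norm ?invr_ge0 ?(ltW nx)// mulVf ?lexx ?gt_eqF.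
Qed.

Lemma opnorm_le f (M : R) :
  (forall x, `|x| <= 1 -> `|f x| <= M%:C) -> opnorm f <= M.
Proof.
move=> fM; apply: ge_sup; first exact: (opset_has_sup f).1.
by move=> _ [x /= x1 <-]; rewrite -lecR Re_norm; exact: fM.
Qed.

Lemma opnorm_ge0 f : 0 <= opnorm f.
Proof.
apply: (ub_le_sup (opset_has_sup f).2).
by exists 0; rewrite /= ?linear0 ?normr0.
Qed.

Let le_opnorm1 f x : `|x| <= 1 -> `|f x| <= (opnorm f)%:C.
Proof.
move=> x1; apply: le_trans (le_opnorm f x) _.
by rewrite ler_piMr// lecR opnorm_ge0.
Qed.

Lemma opnormD f g : (opnorm (f + g))%:C <= (opnorm f)%:C + (opnorm g)%:C.
Proof.
rewrite -rmorphD/= lecR; apply: opnorm_le => x x1.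
rewrite bopD (le_trans (ler_normD _ _))// rmorphD/=.
by rewrite lerD// le_opnorm1.
Qed.

Let opnormZ_le a f : (opnorm (a *: f))%:C <= `|a| * (opnorm f)%:C.
Proof.
have an : (complex.Re `|a|)%:C = `|a| by rewrite RRe_real ?normr_real.
rewrite -an -rmorphM/= lecR; apply: opnorm_le => x x1.
by rewrite bopZ normrZ rmorphM/= an ler_wpM2l// le_opnorm1.
Qed.

Lemma opnormZ a f : (opnorm (a *: f))%:C = `|a| * (opnorm f)%:C.
Proof.
apply/eqP; rewrite eq_le opnormZ_le/=.
have [->|a0] := eqVneq a 0; first by rewrite normr0 mul0r lecR opnorm_ge0.
rewrite -ler_pdivlMl ?normr_gt0// -normfV.
by rewrite (le_trans _ (opnormZ_le _ _))// scalerA mulVf// scale1r.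
Qed.

Lemma opnorm_eq0 f : (opnorm f)%:C = 0 -> f = 0.
Proof.
move=> f0; apply: bop_ext => x; apply/eqP; rewrite -normr_le0.
by rewrite (le_trans (le_opnorm _ _))// f0 mul0r.
Qed.

HB.instance Definition _ :=
  Lmodule_isNormed.Build R[i] (bop H) opnormD opnormZ opnorm_eq0.

Lemma bop_normE f : `|f| = (opnorm f)%:C. Proof. by []. Qed.

End OperatorNorm.

(* An alias is needed: the library already keys a [Complete] instance for
   realType's on [R^o]. *)
Definition complex_line (R : realType) : Type := (R[i])^o.

Section ComplexLine.
Variable R : realType.

HB.instance Definition _ := NormedModule.copy (complex_line R) (R[i])^o.

Let coord_cvg (F : set_system (complex_line R)) (h : R[i] -> R) :
  ProperFilter F -> cauchy F -> (forall u v, `|h u - h v|%:C <= `|u - v|) ->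
  exists l : R, forall e, 0 < e -> \forall z \near F, `|l - h z| < e.
Proof.
move=> FF /cauchyP Fc hlip.
have : cvg (h @ F).
  apply: cauchy_cvg; apply: cauchy_exP => e e0.
  have e0' : 0 < e%:C by rewrite ltcR.
  have [x Fx] := Fc _ e0'; exists (h x).
  change (F (h @^-1` ball (h x) e)); apply: filterS Fx => z xz.
  change (`|h x - h z| < e); rewrite -ltcR.
  have xz' : `|(x : R[i]) - z| < e%:C by [].
  exact: le_lt_trans (hlip _ _) xz'.
move=> /cvg_ex[l hl]; exists l => e e0.
by move/cvgrPdist_lt : hl => /(_ e e0).
Qed.

Let C_complete (F : set_system (complex_line R)) :
  ProperFilter F -> cauchy F -> cvg F.
Proof.
move=> FF Fc.
have [|a Fa] := @coord_cvg F (@complex.Re R) FF Fc.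
  by move=> u v; rewrite -raddfB; exact: normc_ge_Re.
have [|b Fb] := @coord_cvg F (@complex.Im R) FF Fc.
  move=> [u1 u2] [v1 v2] /=; rewrite normc_def lecR /=.
  by rewrite -[leLHS]sqrtr_sqr ler_sqrt ?addr_ge0 ?sqr_ge0// lerDr sqr_ge0.
apply/cvg_ex; exists (a +i* b); apply/cvgrPdist_lt => -[e e'].
rewrite ltcE/= => /andP[/eqP -> e0].
have e2 : 0 < e / 2 by rewrite divr_gt0.
apply: filterS2 (Fa _ e2) (Fb _ e2) => z za zb.
change (`|(a +i* b) - (z : R[i])| < e%:C).
have -> : (a +i* b) - (z : R[i]) =
    (a - complex.Re z)%:C + 'i%C * (b - complex.Im z)%:C.
  by case: (z : R[i]) => z1 z2; simpc.
apply: le_lt_trans (ler_normD _ _) _; rewrite normrM.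
have -> : `|'i%C| = 1 :> R[i] by rewrite normc_def/= expr0n expr1n add0r sqrtr1.
rewrite mul1r !normc_def/= expr0n/= !addr0 !sqrtr_sqr -rmorphD/= ltcR.
by rewrite [ltRHS](splitr e) ltrD.
Qed.

HB.instance Definition _ := Uniform_isComplete.Build (complex_line R) C_complete.

Definition complex_line_dot (x y : complex_line R) : R[i] :=
  (x : R[i]) * Num.conj (y : R[i]).

Let dot_linear : bilinear_for *%R (Num.conj \; *%R) complex_line_dot.
Proof.
split=> [y|x] a u v.
  change (((a : R[i]) * u + v) * Num.conj (y : R[i]) =
    a * (u * Num.conj (y : R[i])) + v * Num.conj (y : R[i])).
  by rewrite mulrDl mulrA.
change ((x : R[i]) * Num.conj ((a : R[i]) * u + v) =
  Num.conj a * (x * Num.conj (u : R[i])) + x * Num.conj (v : R[i])).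
by rewrite rmorphD rmorphM mulrDr /= mulrCA.
Qed.

Let dot_hermitian x y :
  complex_line_dot x y = (-1) ^+ false * Num.conj (complex_line_dot y x).
Proof.
rewrite mul1r; change ((x : R[i]) * Num.conj (y : R[i]) =
  Num.conj ((y : R[i]) * Num.conj (x : R[i]))).
by rewrite rmorphM /= mulrC; congr (_ * _); exact: (esym (conjCK (x : R[i]))).
Qed.

Let dot_norm (x : complex_line R) : `|x| ^+ 2 = complex_line_dot x x.
Proof. exact: normCK. Qed.

Let dot_gt0 (x : complex_line R) : x != 0 -> 0 < complex_line_dot x x.
Proof. by move=> x0; rewrite -dot_norm exprn_gt0// normr_gt0. Qed.

HB.instance Definition _ := bilinear_isBilinear.Build R[i] (complex_line R)
  (complex_line R) R[i] *%R (Num.conj \; *%R) complex_line_dot dot_linear.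
HB.instance Definition _ := isHermitianSesquilinear.Build R[i] (complex_line R)
  false Num.conj complex_line_dot dot_hermitian.
HB.instance Definition _ := isDotProduct.Build R[i] (complex_line R)
  complex_line_dot dot_gt0.
HB.instance Definition _ := isHilbert.Build R (complex_line R) dot_norm.

End ComplexLine.

Section CstarAlgebras.
Variables (R : realType) (H : hilbertType R).
Implicit Types (x y : bop H) (A S T : set (bop H)).

Definition is_adjoint x y := forall u v : H, '<x u, v> = '<u, y v>.

Definition selfadjoint x := is_adjoint x x.

(* In the order of [R[i]], [0 <= z] says that [z] is real and nonnegative. *)
Definition positive_op x := forall u : H, 0 <= '<x u, u>.

Definition le_op x y := positive_op (y - x).

Definition linear_subspace S :=
  S 0 /\ forall (a : R[i]) x y, S x -> S y -> S (a *: x + y).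

(* [S = S^*]; adjoints are unique, so the witness is the adjoint of [x]. *)
Definition star_closed S := forall x, S x -> exists2 y, S y & is_adjoint x y.

Definition operator_space S := linear_subspace S /\ star_closed S.

Definition cstar_algebra A :=
  [/\ operator_space A, forall x y, A x -> A y -> A (x * y) & closed A].

Definition generated_cstar S : set (bop H) := smallest cstar_algebra S.

Definition has_unit A :=
  exists2 e, A e & forall x, A x -> e * x = x /\ x * e = x.

Definition adjoin_unit S : set (bop H) :=
  [set x | exists2 s, S s & exists l, x = s + scalar_op l].

Definition separable_set S :=
  exists D : set (bop H), [/\ countable D, D `<=` S & S `<=` closure D].

Definition linear_on (V : lmodType R[i]) S (f : bop H -> V) :=
  forall (a : R[i]) x y, S x -> S y -> f (a *: x + y) = a *: f x + f y.

Definition positive_functional A (f : bop H -> R[i]) :=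
  linear_on (V := (R[i])^o) A f /\ forall x, A x -> positive_op x -> 0 <= f x.

Definition strictly_positive A p :=
  [/\ A p, positive_op p &
    forall f, positive_functional A f ->
      f p = 0 -> forall x, A x -> f x = 0].

Definition almost_dominated S x :=
  exists s : nat -> bop H, forall n, (0 < n)%N ->
    [/\ S (s n), selfadjoint (s n) & le_op x (s n + scalar_op n%:R^-1)].

(* An [n] by [n] matrix of operators on [H], acting on [H^n]. *)
Definition positive_mx n (a : 'M[bop H]_n) :=
  forall u : 'I_n -> H, 0 <= \sum_i '<\sum_j a i j (u j), u i>.

End CstarAlgebras.

(* Maps into [bop K] are total functions, of which only the values on the
    indicated domain matter. *)

Section BoundaryRepresentations.
Variables (R : realType) (H K : hilbertType R).
Implicit Types (A T : set (bop H)) (f g : bop H -> bop K).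

Definition completely_positive T f :=
  forall n (a : 'M[bop H]_n), (forall i j, T (a i j)) ->
    positive_mx a -> positive_mx (map_mx f a).

Definition ucp T f := [/\ linear_on T f, f 1 = 1 & completely_positive T f].

Definition multiplicative_on A f :=
  forall x y, A x -> A y -> f (x * y) = f x * f y.

Definition agree_on T f g := forall x, T x -> f x = g x.

Definition ucp_extension T f g := ucp (generated_cstar T) g /\ agree_on T g f.

Definition unique_extension_property T f :=
  ucp T f /\
  exists g, [/\ ucp_extension T f g,
    forall g', ucp_extension T f g' -> agree_on (generated_cstar T) g' g &
    multiplicative_on (generated_cstar T) g].

Definition representation A f :=
  [/\ linear_on A f, multiplicative_on A f &
    forall x y, A x -> A y -> is_adjoint x y -> is_adjoint (f x) (f y)].

Definition invariant_subspace A f (M : set K) :=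
  [/\ closed M, M 0, forall (a : R[i]) u v, M u -> M v -> M (a *: u + v) &
    forall x u, A x -> M u -> M (f x u)].

Definition irreducible_on A f :=
  (exists2 x, A x & f x != 0) /\
  forall M, invariant_subspace A f M -> M = [set 0] \/ M = setT.

Definition boundary_representation T f :=
  [/\ representation (generated_cstar T) f, irreducible_on (generated_cstar T) f &
    unique_extension_property T f].

End BoundaryRepresentations.

Section RepresentationAtInfinity.
Variables (R : realType) (H : hilbertType R).
Implicit Types (A : set (bop H)) (x : bop H).

Definition infinity_coef A x : R[i] := xget 0 [set l | A (x - scalar_op l)].

(* [C] acts on the one-dimensional Hilbert space by scalar operators. *)
Definition pi_infty A x : bop (complex_line R) :=
  scalar_op (infinity_coef A x).

Lemma pi_inftyE A a (l : R[i]) : cstar_algebra A -> ~ has_unit A -> A a ->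
  pi_infty A (a + scalar_op l) = scalar_op l.
Proof.
move=> [[[A0 Alin] _] _ _] Anu Aa; congr scalar_op.
apply: xget_unique => [|m /= Am]; first by rewrite /= addrK.
apply: contra_notP Anu => /eqP lm.
have A1 : A 1.
  have := Alin (-1) _ _ Aa Am.
  rewrite scaleN1r -addrA addKr /scalar_op -scalerBl => Alm.
  have := Alin (l - m)^-1 _ _ Alm A0.
  by rewrite addr0 scalerA mulVf ?scale1r// subr_eq0 eq_sym.
by exists 1 => // x _; rewrite mul1r mulr1.
Qed.

End RepresentationAtInfinity.

(* Main.v *)
(* UCP maps into the operators on a one-dimensional space are the states, so
   [pi_infty] is a boundary representation exactly when it is the only state of
   the unitization of [A] that vanishes on [S]. If [s_n + 1/n >= x] with [s_n] in
   [S], such a state [f] satisfies [f x <= 1/n] for all [n]: this gives (iii) =>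
   (i), and for a strictly positive [x] it forces [f] to vanish on [A], whence
   (ii) => (i). Conversely, a Hahn-Banach argument for the sublinear map
   [x |-> inf {l | s + l >= x for some s in S}] produces a state vanishing on [S]
   whose value at [x] is this infimum, so (i) makes the infimum 0, which is (iii).
   For (iii) => (ii) only the existence of a strictly positive [p] matters. For
   each [d] in a countable dense subset of [S] let [q] dominate [d^* d] and the
   moduli of the real and imaginary parts of [d]; if [p] is a weighted sum of the
   [q]'s, a positive functional with [f p = 0] vanishes on [S] and on [A S], hence
   on the C*-algebra [A] generated by [S]. *)

From HB Require Import structures.
Require Import Defs.
From mathcomp Require Import all_boot all_order all_algebra.
From mathcomp Require Import sesquilinear complex ring lra.
From mathcomp Require Import all_classical all_reals all_analysis.

Set Implicit Arguments.
Unset Strict Implicit.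
Unset Printing Implicit Defensive.

Import Order.TTheory GRing.Theory Num.Theory.
Import numFieldNormedType.Exports.

Local Open Scope classical_set_scope.
Local Open Scope ring_scope.
Local Open Scope complex_scope.

(** * Positive operators *)

(** The order on operators is read off quadratic forms; neither the spectral theorem nor the GNS
    construction is used. One polynomial iteration replaces functional calculus: for self-adjoint
    [x] in [A] it gives [r] in [A] with [r >= x] and [r >= -x], and only these two inequalities are
    ever needed. The iterates involve the unit, which [A] does not contain, so each one is corrected
    by its scalar part. Beyond making [l] in [a + l] unique, nonunitality acts through one estimate,
    [|l| <= |a + l|] for [a] in [A]. It makes the unitization closed, makes the character at
    infinity positive, and keeps the infimum of the overview above [- |x|]. A positive functional is
    only assumed linear and positive on [A], while passing from a dense sequence to [S] and from [S]
    to [A] takes limits. Its boundedness is therefore proved first, again from the dominating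
    elements [r]. The Hahn-Banach functional lives on the real space of all bounded operators, where
    real parts of quadratic forms stand in for the order; on self-adjoint operators the two
    agree. *)

Section InnerProduct.
Variables (R : realType) (H : hilbertType R).
Implicit Types (u v w : H) (a : R[i]).

Lemma dotC u v : '<u, v> = Num.conj '<v, u>.
Proof. by rewrite hermC mul1r. Qed.

Lemma dotDl u v w : '<u + v, w> = '<u, w> + '<v, w>.
Proof. exact: linearDl. Qed.

Lemma dotDr u v w : '<w, u + v> = '<w, u> + '<w, v>.
Proof. exact: linearDr. Qed.

Lemma dotNl u w : '<- u, w> = - '<u, w>.
Proof. exact: linearNl. Qed.

Lemma dotNr u w : '<w, - u> = - '<w, u>.
Proof. exact: linearNr. Qed.

Lemma dotBl u v w : '<u - v, w> = '<u, w> - '<v, w>.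
Proof. by rewrite dotDl dotNl. Qed.

Lemma dotBr u v w : '<w, u - v> = '<w, u> - '<w, v>.
Proof. by rewrite dotDr dotNr. Qed.

Lemma dotZl a u w : '<a *: u, w> = a * '<u, w>.
Proof. exact: linearZl_LR. Qed.

Lemma dotZr a u w : '<w, a *: u> = Num.conj a * '<w, u>.
Proof. by rewrite linearZr_LR. Qed.

Lemma dot0l w : '<0, w> = 0.
Proof. exact: linear0l. Qed.

Lemma dot0r w : '<w, 0> = 0.
Proof. exact: linear0r. Qed.

Lemma dot_ge0 u : 0 <= '<u, u>.
Proof. by rewrite -hdot_norm exprn_ge0. Qed.

Lemma cauchy_schwarz u v : `|'<u, v>| <= `|u| * `|v|.
Proof.
have [->|v0] := eqVneq v 0; first by rewrite dot0r !normr0 mulr0.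
have nv : 0 < `|v| by rewrite normr_gt0.
have vv : '<v, v> = `|v| ^+ 2 by rewrite hdot_norm.
set c := '<u, v> / '<v, v>.
have := dot_ge0 (u - c *: v).
have cvu : '<c *: v, u> = '<c *: v, c *: v>.
  rewrite !dotZl dotZr [Num.conj c]rmorphM fmorphV /= -!dotC.
  by rewrite mulfVK// vv expf_neq0// gt_eqF.
have cuv : '<u, c *: v> = '<c *: v, c *: v>.
  by rewrite dotC cvu -dotC.
rewrite dotBl !dotBr cvu cuv subrr subr0 subr_ge0 -!hdot_norm normrZ.
have -> : `|c| = `|'<u, v>| / `|v| ^+ 2.
  by rewrite normrM normfV vv (ger0_norm (exprn_ge0 2 (ltW nv))).
move=> h.
have {}h : `|'<u, v>| / `|v| ^+ 2 * `|v| <= `|u|.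
  by rewrite -ler_sqr ?nnegrE ?mulr_ge0 ?invr_ge0 ?exprn_ge0.
have -> : `|'<u, v>| = `|'<u, v>| / `|v| ^+ 2 * `|v| * `|v|.
  by rewrite -mulrA -expr2 mulfVK// expf_neq0// gt_eqF.
by rewrite ler_wpM2r.
Qed.

Lemma dot_ext u v : (forall w, '<u, w> = '<v, w>) -> u = v.
Proof.
move=> uv; apply/eqP; rewrite -subr_eq0 -normr_eq0 -sqrf_eq0 hdot_norm.
by rewrite dotBl uv subrr.
Qed.

End InnerProduct.

Section Operators.
Variables (R : realType) (H : hilbertType R).
Implicit Types (x y s t : bop H) (u v : H) (a : R[i]).

Lemma bopB x y u : (x - y) u = x u - y u.
Proof. by []. Qed.

Lemma opB x u v : x (u - v) = x u - x v.
Proof. exact: linearB. Qed.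

Lemma opZ a x u : x (a *: u) = a *: x u.
Proof. exact: linearZ. Qed.

Lemma bopZl a x y : (a *: x) * y = a *: (x * y).
Proof. exact: bop_ext. Qed.

Lemma bopZr a x y : x * (a *: y) = a *: (x * y).
Proof. by apply: bop_ext => u; rewrite bopM !bopZ linearZ. Qed.

Lemma scalar_opE a u : scalar_op a u = a *: u.
Proof. by []. Qed.

Lemma is_adjoint_sym x y : is_adjoint x y -> is_adjoint y x.
Proof. by move=> xy u v; rewrite dotC -xy -dotC. Qed.

Lemma is_adjoint_inj x y z : is_adjoint x y -> is_adjoint x z -> y = z.
Proof.
move=> /is_adjoint_sym xy /is_adjoint_sym xz; apply: bop_ext => u.
by apply: dot_ext => w; rewrite xy xz.
Qed.

Lemma is_adjoint_lin a x y s t : is_adjoint x y -> is_adjoint s t ->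
  is_adjoint (a *: x + s) (Num.conj a *: y + t).
Proof.
move=> xy st u v; rewrite !bopD !bopZ dotDl dotDr dotZl dotZr xy st.
by rewrite conjCK.
Qed.

Lemma is_adjointM x y s t : is_adjoint x y -> is_adjoint s t ->
  is_adjoint (x * s) (t * y).
Proof. by move=> xy st u v; rewrite !bopM xy st. Qed.

Lemma selfadjoint1 : selfadjoint (1 : bop H).
Proof. by []. Qed.

Lemma is_adjoint0 : is_adjoint (0 : bop H) 0.
Proof. by move=> u v; rewrite !bop0 dot0l dot0r. Qed.

Lemma is_adjointZ a x y : is_adjoint x y -> is_adjoint (a *: x) (Num.conj a *: y).
Proof.
by move=> xy; have := is_adjoint_lin a xy is_adjoint0; rewrite !addr0.
Qed.

Lemma is_adjointD x y s t : is_adjoint x y -> is_adjoint s t ->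
  is_adjoint (x + s) (y + t).
Proof.
by move=> xy st; have := is_adjoint_lin 1 xy st; rewrite rmorph1 !scale1r.
Qed.

Lemma is_adjointN x y : is_adjoint x y -> is_adjoint (- x) (- y).
Proof.
by move=> /(is_adjointZ (-1)); rewrite rmorphN rmorph1 !scaleN1r.
Qed.

Lemma selfadjointB x y : selfadjoint x -> selfadjoint y -> selfadjoint (x - y).
Proof. by move=> xx /is_adjointN; exact: is_adjointD. Qed.

Lemma conj_real (r : R) : Num.conj r%:C = r%:C :> R[i].
Proof. by apply: conj_Creal; rewrite complex_real. Qed.

Lemma selfadjointZ (r : R) x : selfadjoint x -> selfadjoint (r%:C *: x).
Proof. by move=> /(is_adjointZ r%:C); rewrite conj_real. Qed.

Lemma selfadjoint_scalar (r : R) : selfadjoint (scalar_op r%:C : bop H).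
Proof. exact: selfadjointZ selfadjoint1. Qed.

Lemma selfadjoint_dot_real x u : selfadjoint x -> '<x u, u> \is Num.real.
Proof. by move=> xx; apply/CrealP; rewrite -dotC xx. Qed.

(** Polarization: the form is real at [u + v] and at [u + 'i *: v], and these two equations together
    give ['<x u, v> = '<u, x v>]. *)
Lemma positive_selfadjoint x : positive_op x -> selfadjoint x.
Proof.
move=> x0 u v; have xr w : '<x w, w> = '<w, x w>.
  by rewrite [RHS]dotC (conj_Creal (ger0_real (x0 w))).
move: (xr (u + v)) (xr (u + 'i *: v)).
rewrite !linearD !linearZ/= !(dotDl, dotDr) !(dotZl, dotZr).
rewrite !xr !conjCi.
set p := '<u, x u>; set q := '<v, x v>.
set A := '<x u, v>; set B := '<x v, u>; set C := '<u, x v>; set D := '<v, x u>.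
move=> /eqP; rewrite -subr_eq0 => /eqP e1 /eqP; rewrite -subr_eq0 => /eqP e2.
have e3 : A + B - C - D = 0 by rewrite -e1; ring.
have e4 : 'i * (A - B - C + D) = 0 by rewrite -[RHS]oppr0 -e2; ring.
have : ('i *+ 2) * (A - C) = 'i * (A + B - C - D) + 'i * (A - B - C + D) by ring.
rewrite e3 e4 mulr0 addr0.
move/eqP; rewrite mulf_eq0 mulrn_eq0 (negbTE (neq0Ci _))/= subr_eq0.
by move/eqP.
Qed.

Lemma positive0 : positive_op (0 : bop H).
Proof. by move=> u; rewrite bop0 dot0l. Qed.

Lemma positive1 : positive_op (1 : bop H).
Proof. exact: dot_ge0. Qed.

Lemma positiveD x y : positive_op x -> positive_op y -> positive_op (x + y).
Proof. by move=> x0 y0 u; rewrite bopD dotDl addr_ge0. Qed.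

Lemma positiveZ a x : 0 <= a -> positive_op x -> positive_op (a *: x).
Proof. by move=> a0 x0 u; rewrite bopZ dotZl mulr_ge0. Qed.

Lemma positive_conj s t x : is_adjoint s t -> positive_op x ->
  positive_op (t * x * s).
Proof.
by move=> /is_adjoint_sym ts x0 u; rewrite !bopM ts.
Qed.

Lemma positive_adjM s t : is_adjoint s t -> positive_op (t * s).
Proof. by move=> /positive_conj/(_ positive1); rewrite mulr1. Qed.

Lemma opnormM x y : opnorm (x * y) <= opnorm x * opnorm y.
Proof.
apply: opnorm_le => u u1; rewrite bopM (le_trans (le_opnorm _ _))//.
rewrite rmorphM/= ler_wpM2l ?lecR ?opnorm_ge0//.
by rewrite (le_trans (le_opnorm _ _))// ler_piMr// lecR opnorm_ge0.
Qed.

Lemma opnorm1 : opnorm (1 : bop H) <= 1.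
Proof. by apply: opnorm_le => u u1. Qed.

Lemma opnormDr x y : opnorm (x + y) <= opnorm x + opnorm y.
Proof. by rewrite -lecR rmorphD/= opnormD. Qed.

Lemma opnormZr (r : R) x : 0 <= r -> opnorm (r%:C *: x) = r * opnorm x.
Proof.
by move=> r0; apply/complexI; rewrite opnormZ rmorphM/= ger0_norm// lecR.
Qed.

Lemma opnormN x : opnorm (- x) = opnorm x.
Proof. by apply/complexI; rewrite -!bop_normE normrN. Qed.

Lemma opnorm_adjoint x y : is_adjoint x y -> opnorm y <= opnorm x.
Proof.
move=> /is_adjoint_sym yx; apply: opnorm_le => u u1.
have h : `|y u| ^+ 2 <= (opnorm x)%:C * `|y u|.
  rewrite hdot_norm -(ger0_norm (dot_ge0 (y u))) yx.
  rewrite (le_trans (cauchy_schwarz _ _))//.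
  rewrite (le_trans (ler_wpM2l (normr_ge0 _) (le_opnorm _ _)))//.
  by rewrite ler_piMl// mulr_ge0// lecR opnorm_ge0.
have [->|yu] := eqVneq `|y u| 0; first by rewrite lecR opnorm_ge0.
by move: h; rewrite expr2 ler_pM2r // lt0r yu normr_ge0.
Qed.

Lemma dot_opnorm x u : `|'<x u, u>| <= (opnorm x)%:C * '<u, u>.
Proof.
rewrite (le_trans (cauchy_schwarz _ _))// -hdot_norm expr2 mulrA.
by rewrite ler_wpM2r// le_opnorm.
Qed.

Lemma selfadjoint_le_opnorm x (c : R) : selfadjoint x -> opnorm x <= c ->
  positive_op (scalar_op c%:C - x).
Proof.
move=> xx xc u; rewrite bopB scalar_opE dotBl dotZl subr_ge0.
rewrite (le_trans (real_ler_norm (selfadjoint_dot_real u xx)))//.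
by rewrite (le_trans (dot_opnorm _ _))// ler_wpM2r ?dot_ge0// lecR.
Qed.

(** The identity [x (c - x) x + (c - x) x (c - x) = c x (c - x)] has conjugates of positive
    operators on its left side, so [x (c - x)] is positive without any square root. *)
Lemma positive_norm2 x (c : R) u : 0 < c -> positive_op x ->
  positive_op (scalar_op c%:C - x) -> '<x u, x u> <= c%:C * '<x u, u>.
Proof.
move=> c0 x0 cx; have xx := positive_selfadjoint x0.
have c0' : 0 < c%:C by rewrite ltcR.
have := addr_ge0 (cx (x u)) (x0 (c%:C *: u - x u)).
rewrite bopB scalar_opE !(dotBl, dotBr) !(dotZl, dotZr) conj_real -!xx.
rewrite !(opB, opZ) !(dotBl, dotZl).
set A := '<x u, u>; set B := '<x (x u), u>.
set D := '<x (x (x u)), u>; rewrite -subr_ge0 => h.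
rewrite -(pmulr_rge0 _ c0') (le_trans h)// le_eqVlt; apply/orP; left.
by apply/eqP; ring.
Qed.

Lemma positive_le_opnorm x (c : R) : 0 < c -> positive_op x ->
  positive_op (scalar_op c%:C - x) -> opnorm x <= c.
Proof.
move=> c0 x0 cx; apply: opnorm_le => u u1.
have c0' : 0 < c%:C by rewrite ltcR.
rewrite -ler_sqr ?nnegrE ?(ltW c0')// hdot_norm.
rewrite (le_trans (positive_norm2 u c0 x0 cx))// expr2 ler_wpM2l ?(ltW c0')//.
have := cx u; rewrite bopB scalar_opE dotBl dotZl subr_ge0 => /le_trans; apply.
by rewrite ler_piMr ?(ltW c0')// -hdot_norm expr_le1.
Qed.

Lemma positive_1sub_sqr x : selfadjoint x -> opnorm x <= 1 ->
  positive_op (1 - x * x).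
Proof.
move=> xx x1 u; rewrite bopB bop1 bopM dotBl xx -!hdot_norm subr_ge0.
rewrite ler_sqr ?nnegrE// (le_trans (le_opnorm _ _))//.
by rewrite ler_piMl// lecR.
Qed.

End Operators.

(** * Products of commuting positive operators *)

Section CommutingProduct.
Variables (R : realType) (H : hilbertType R).
Implicit Types (x y s t : bop H) (u v : H).

Lemma complex_archimedean (x y : R[i]) :
  0 < x -> (forall n, n%:R * x <= y) -> False.
Proof.
move=> x0 xy; have xr : x = (complex.Re x)%:C by rewrite RRe_real ?gtr0_real.
have y0 : 0 <= y by rewrite -[leLHS](mul0r x) (xy 0).
have yr : y = (complex.Re y)%:C by rewrite RRe_real ?ger0_real.
move: x0; rewrite xr ltcR => x0.
have := archi_boundP (divr_ge0 (_ : 0 <= complex.Re y) (ltW x0)).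
rewrite -lecR -yr y0 => /(_ isT); apply/negP; rewrite -leNgt.
rewrite ler_pdivlMr// -lecR -yr rmorphM/= -xr rmorph_nat; exact: xy.
Qed.

Lemma positive_sub_sqr x : positive_op x -> positive_op (1 - x) ->
  positive_op (x - x * x) /\ positive_op (1 - (x - x * x)).
Proof.
move=> x0 x1; have xx := positive_selfadjoint x0; split; last first.
  by rewrite opprB addrCA addrC; apply: positiveD => //; exact: positive_adjM.
move=> u; rewrite bopB bopM dotBl (xx (x u)) subr_ge0.
have := @positive_norm2 _ _ _ 1 u ltr01 x0; rewrite mul1r; apply.
by rewrite /scalar_op scale1r.
Qed.

(* If [r 0 = s] and [r n.+1 = r n - r n ^ 2], then [s] is the sum of the
   [r k ^ 2] for [k < n] plus [r n], which tends strongly to 0; hence [t * s] is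
   a limit of sums of the positive operators [r k * t * r k]. *)
Lemma positive_mul_le1 s t : positive_op s -> positive_op (1 - s) ->
  positive_op t -> t * s = s * t -> positive_op (t * s).
Proof.
move=> s0 s1 t0 ts; pose r n := iter n (fun x => x - x * x) s.
have rP n : [/\ positive_op (r n), positive_op (1 - r n) & t * r n = r n * t].
  elim: n => [//|n [p q c]]; have [p' q'] := positive_sub_sqr p q.
  by split=> //; rewrite /r iterS -/(r n) mulrBr mulrBl mulrA c -!mulrA c.
have rr n : selfadjoint (r n) by apply: positive_selfadjoint; case: (rP n).
have rS n : r n = r n * r n + r n.+1 by rewrite /r iterS addrC subrK.
have tele u n : '<(t * s) u, u> =
    \sum_(k < n) '<t (r k u), r k u> + '<t (r n u), u>.
  elim: n => [|n ->]; first by rewrite big_ord0 add0r.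
  rewrite big_ord_recr/= -addrA; congr (_ + _); rewrite -bopM {1}rS mulrDr.
  rewrite bopD dotDl; congr (_ + _); have [_ _ c] := rP n.
  have -> : t * (r n * r n) = r n * (t * r n) by rewrite mulrA {1}c -mulrA.
  by rewrite bopM rr.
have tele2 u n : '<s u, u> = \sum_(k < n) '<r k u, r k u> + '<r n u, u>.
  elim: n => [|n ->]; first by rewrite big_ord0 add0r.
  rewrite big_ord_recr/= -addrA; congr (_ + _); rewrite {1}rS.
  by rewrite bopD dotDl bopM rr.
have tsa : selfadjoint (t * s).
  rewrite /selfadjoint {2}ts.
  by apply: is_adjointM; exact: positive_selfadjoint.
move=> u; have zr := selfadjoint_dot_real u tsa.
have [//|z0] := real_leP (real0 _) zr; set z := '<_, _> in zr z0 *.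
pose K := (opnorm t)%:C * `|u|.
have K0 : 0 <= K by rewrite mulr_ge0// lecR opnorm_ge0.
(* If [z] were negative, this would bound the norms of all [r n u] below by a positive constant,
   while by [tele2] their squares sum to at most ['<s u, u>]. *)
have zK n : (- z) ^+ 2 <= K ^+ 2 * '<r n u, r n u>.
  rewrite -hdot_norm -exprMn ler_sqr ?nnegrE.
  2, 3: by rewrite ?(mulr_ge0 K0 (normr_ge0 _)) ?oppr_ge0 ?(ltW z0).
  have zt : - z <= - '<t (r n u), u>.
    rewrite lerN2 (tele u n : z = _) lerDr sumr_ge0// => k _; exact: t0.
  have tr : - '<t (r n u), u> \is Num.real.
    by apply: ger0_real; apply: le_trans zt; rewrite oppr_ge0 ltW.
  apply: le_trans zt (le_trans (real_ler_norm tr) _).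
  rewrite normrN (le_trans (cauchy_schwarz _ _))// mulrAC.
  by rewrite ler_wpM2r// le_opnorm.
exfalso; apply: (@complex_archimedean ((- z) ^+ 2) (K ^+ 2 * '<s u, u>)).
  by rewrite exprn_gt0// oppr_gt0.
move=> n; rewrite (tele2 u n) mulrDr mulr_sumr.
rewrite -[leLHS]addr0; apply: lerD; last first.
  by apply: mulr_ge0; [exact: exprn_ge0|case: (rP n) => + _ _; exact].
rewrite mulr_natl -[X in _ *+ X]card_ord -sumr_const.
by apply: ler_sum => k _; exact: zK.
Qed.

Lemma positive_mul_comm s t : positive_op s -> positive_op t ->
  t * s = s * t -> positive_op (t * s).
Proof.
move=> s0 t0 ts; pose c : R := opnorm s + 1.
have c0 : 0 < c by rewrite ltr_wpDl ?opnorm_ge0.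
have c0' : 0 < c%:C^-1 :> R[i] by rewrite invr_gt0 ltcR.
have cs : positive_op (t * (c%:C^-1 *: s)).
  apply: positive_mul_le1 => //; first exact: positiveZ (ltW c0') s0.
    have -> : 1 - c%:C^-1 *: s = c%:C^-1 *: (scalar_op c%:C - s).
      by rewrite scalerBr /scalar_op scalerA mulVf ?scale1r// -invr_eq0 gt_eqF.
    apply: positiveZ (ltW c0') _; apply: selfadjoint_le_opnorm.
      exact: positive_selfadjoint.
    by rewrite lerDl.
  by rewrite bopZr bopZl ts.
have -> : t * s = c%:C *: (t * (c%:C^-1 *: s)).
  by rewrite bopZr scalerA mulfV ?scale1r// -invr_eq0 gt_eqF.
by apply: positiveZ cs; rewrite lecR ltW.
Qed.

End CommutingProduct.

(** * Completeness of the algebra of bounded operators *)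

Section Limits.
Variable R : realType.

Lemma gt0_complexE (e : R[i]) : 0 < e -> exists2 r : R, 0 < r & e = r%:C.
Proof.
move=> e0; exists (complex.Re e); last by rewrite RRe_real ?gtr0_real.
by move: e0; rewrite ltcE => /andP[].
Qed.

Lemma normr_ReE (V : normedModType R[i]) (x : V) : `|x| = (complex.Re `|x|)%:C.
Proof. by rewrite RRe_real ?normr_real. Qed.

Lemma Re_ge0 (z : R[i]) : 0 <= z -> 0 <= complex.Re z.
Proof. by rewrite lecE => /andP[]. Qed.

Lemma normr_le_eps (V : normedModType R[i]) (x : V) (r : R) :
  (forall e : R, 0 < e -> `|x| <= (r + e)%:C) -> `|x| <= r%:C.
Proof.
move=> h; rewrite normr_ReE lecR; apply/ler_addgt0Pr => e e0.
by rewrite -lecR -normr_ReE h.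
Qed.

Lemma closureP_norm (V : normedModType R[i]) (S : set V) (x : V) :
  closure S x <-> forall e : R, 0 < e -> exists2 y, S y & `|x - y| <= e%:C.
Proof.
split=> [Sx e e0|h B /nbhs_ballP[_ /= /gt0_complexE[e e0 ->] eB]].
  have e0' : 0 < e%:C by rewrite ltcR.
  have [y [Sy xy]] := Sx _ (nbhsx_ballx x _ e0').
  by exists y => //; move: xy; rewrite -ball_normE => /ltW.
have e20 : 0 < e / 2 by rewrite divr_gt0.
have [y Sy xy] := h _ e20; exists y; split=> //; apply: eB.
rewrite -ball_normE /=; apply: le_lt_trans xy _.
by rewrite ltcR ltr_pdivrMr// ltr_pMr// ltr1n.
Qed.

(** A majorizing real sequence [c] replaces the Cauchy condition, so that the limit comes with the
    explicit error [L - c n]. It is applied, directly or through [bop_complete], with [geom_sum] and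
    with [sqrt_radius]. *)
Lemma dominated_seq_cvg (V : completeNormedModType R[i]) (u : nat -> V)
    (c : nat -> R) (L : R) :
  (forall n, `|u n.+1 - u n| <= (c n.+1 - c n)%:C) -> (forall n, c n <= L) ->
  (forall e : R, 0 < e -> exists n, L - c n <= e) ->
  exists2 l, u @ \oo --> l & forall n, `|l - u n| <= (L - c n)%:C.
Proof.
move=> uc cL Lc.
have um n m : (n <= m)%N -> `|u m - u n| <= (c m - c n)%:C.
  move=> /subnK <-; elim: (m - n)%N => [|k ih].
    by rewrite add0n !subrr normr0.
  rewrite addSn -(subrKA (u (k + n)%N)) (le_trans (ler_normD _ _))//.
  by rewrite -(subrKA (c (k + n)%N)) rmorphD lerD.
have umL n m : (n <= m)%N -> `|u m - u n| <= (L - c n)%:C.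
  by move=> /um /le_trans; apply; rewrite lecR lerD2r.
have /cvg_ex[/= l ul] : cvg (u @ \oo).
  apply: cauchy_cvg; apply: cauchy_exP => _ /gt0_complexE[e e0 ->].
  have e20 : 0 < e / 2 by rewrite divr_gt0.
  have [n Ln] := Lc _ e20; exists (u n); exists n => // m /= nm.
  rewrite -ball_normE /= distrC; apply: le_lt_trans (umL _ _ nm) _.
  by rewrite ltcR (le_lt_trans Ln)// ltr_pdivrMr// ltr_pMr// ltr1n.
exists l => // n; apply: normr_le_eps => e e0.
have e0' : 0 < e%:C by rewrite ltcR.
have /cvgrPdist_le/(_ _ e0')[m _ ml] := ul.
rewrite -(subrKA (u (maxn m n))) (le_trans (ler_normD _ _))//.
by rewrite addrC rmorphD lerD ?umL ?leq_maxr// ml//= leq_maxl.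
Qed.

Definition geom_sum (n : nat) : R := 1 - 2^-1 ^+ n.

Lemma geom_sumS n : geom_sum n.+1 - geom_sum n = 2^-1 ^+ n.+1.
Proof. by rewrite /geom_sum opprB addrC subrKA exprS; lra. Qed.

Lemma geom_sum_le1 n : geom_sum n <= 1.
Proof. by rewrite gerBl exprn_ge0// invr_ge0. Qed.

Lemma geom_sum_sup (e : R) : 0 < e -> exists n, 1 - geom_sum n <= e.
Proof.
move=> e0; have : (2^-1 ^+ n : R) @[n --> \oo] --> (0 : R).
  by apply: cvg_expr; rewrite ger0_norm ?invr_ge0// invf_lt1// ltr1n.
move=> /cvgrPdist_le/(_ e e0)[n _ /(_ n (leqnn n))] h; exists n.
rewrite /geom_sum opprB addrC subrK (le_trans _ h)// sub0r normrN.
exact: ler_norm.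
Qed.

End Limits.

Section OperatorLimits.
Variables (R : realType) (H : hilbertType R).
Implicit Types (x y : bop H) (S : set (bop H)).

Lemma closureP_op S x :
  closure S x <-> forall e : R, 0 < e -> exists2 y, S y & opnorm (x - y) <= e.
Proof.
rewrite closureP_norm; split=> h e e0; have [y Sy xy] := h e e0; exists y => //.
  by rewrite -lecR.
by rewrite bop_normE lecR.
Qed.

Lemma closed_op S x : closed S ->
  (forall e : R, 0 < e -> exists2 y, S y & opnorm (x - y) <= e) -> S x.
Proof. by move=> cS h; apply: cS; apply/closureP_op. Qed.

(** The limit is taken pointwise; the error estimate at [n = 0] makes it bounded, and the estimates
    at all [n] are uniform on the unit ball. *)
Lemma bop_complete (u : nat -> bop H) (c : nat -> R) (L : R) :
  (forall n, opnorm (u n.+1 - u n) <= c n.+1 - c n) -> (forall n, c n <= L) ->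
  (forall e : R, 0 < e -> exists n, L - c n <= e) ->
  exists l, forall n, opnorm (l - u n) <= L - c n.
Proof.
move=> uc cL Lc.
have /choice[l lP] (v : H) : exists l, u ^~ v @ \oo --> l /\
    forall n, `|l - u n v| <= (L - c n)%:C * `|v|.
  have nv := normr_ReE v.
  have v0 : 0 <= complex.Re `|v| by exact: Re_ge0.
  have [||e e0|l ul lu] := @dominated_seq_cvg _ _ (u ^~ v)
      (fun n => c n * complex.Re `|v|) (L * complex.Re `|v|).
  - move=> n; rewrite -bopB (le_trans (le_opnorm _ _))// -mulrBl rmorphM/= -nv.
    by rewrite ler_wpM2r// lecR.
  - by move=> n; rewrite ler_wpM2r.
  - have v1 : 0 < complex.Re `|v| + 1 by rewrite ltr_wpDl.
    have [n Ln] := Lc _ (divr_gt0 e0 v1); exists n; rewrite -mulrBl.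
    rewrite (le_trans (ler_wpM2r v0 Ln))// mulrAC ler_pdivrMr//.
    by rewrite ler_wpM2l ?(ltW e0)// lerDl.
  - by exists l; split=> // n; rewrite (le_trans (lu n))// -mulrBl rmorphM/= -nv.
have ul v : u ^~ v @ \oo --> l v by case: (lP v).
have lu v n : `|l v - u n v| <= (L - c n)%:C * `|v| by case: (lP v).
have llin : linear l.
  move=> a v w; apply: (cvg_unique _ (ul (a *: v + w))) => //.
  have -> : u ^~ (a *: v + w) = (fun n => a *: u n v + u n w).
    by apply/funext => n; exact: bop_linear.
  by apply: cvgD; [apply: cvgZr; exact: ul|exact: ul].
pose l' : {linear H -> H} := HB.pack l (GRing.isLinear.Build _ _ _ _ l llin).
have lcont : continuous l.
  apply/(linear_bounded_continuous l')/linear_boundedP.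
  exists ((L - c 0%N)%:C + (opnorm (u 0%N))%:C); split.
    by rewrite -rmorphD complex_real.
  move=> r /ltW r0 v /=; rewrite -(subrK (u 0%N v) (l v)).
  rewrite (le_trans (ler_normD _ _))// (le_trans _ (ler_wpM2r _ r0))//.
  by rewrite mulrDl lerD// le_opnorm.
have lb : bounded_op l by apply/asboolP.
exists (Bop lb) => n; apply: opnorm_le => v v1; rewrite bopB /=.
by rewrite (le_trans (lu _ _))// ler_piMr// lecR subr_ge0.
Qed.

Lemma is_adjoint_closed (x z : bop H) :
  (forall e : R, 0 < e -> exists y w,
    [/\ is_adjoint y w, opnorm (x - y) <= e & opnorm (z - w) <= e]) ->
  is_adjoint x z.
Proof.
move=> h u v; apply/eqP; rewrite -subr_eq0 -normr_le0.
apply: (@normr_le_eps R (R[i])^o _ 0) => e e0; rewrite add0r.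
pose K := complex.Re (`|u| * `|v|) *+ 2 + 1.
have K1 : K%:C = `|u| * `|v| *+ 2 + 1.
  by rewrite rmorphD rmorphMn /= RRe_real// realM ?normr_real.
have K0 : 0 < K by rewrite -ltcR K1 ltr_wpDl// mulrn_wge0// mulr_ge0.
have [y [w [yw xy zw]]] := h _ (divr_gt0 e0 K0).
have -> : '<x u, v> - '<u, z v> = '<(x - y) u, v> - '<u, (z - w) v>.
  by rewrite !bopB dotBl dotBr yw; ring.
rewrite (le_trans (ler_normB _ _))//.
have small (t : bop H) (s s' : H) : opnorm t <= e / K ->
    `|t s| * `|s'| <= (e / K)%:C * (`|s| * `|s'|).
  move=> te; rewrite mulrA ler_wpM2r// (le_trans (le_opnorm _ _))//.
  by rewrite ler_wpM2r// lecR.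
rewrite (le_trans (lerD (cauchy_schwarz _ _) (cauchy_schwarz _ _)))//.
rewrite [X in _ + X]mulrC.
rewrite (le_trans (lerD (small _ u v xy) (small _ v u zw)))//.
rewrite (mulrC `|v|) -mulr2n -mulrnAr -[leRHS]mulr1.
rewrite -[in leRHS](divfK (lt0r_neq0 K0) e) [in leRHS]rmorphM/= -mulrA mulr1.
rewrite ler_wpM2l ?lecR ?(ltW (divr_gt0 e0 K0))// K1.
by rewrite lerDl.
Qed.

Lemma positive_closed x :
  (forall e : R, 0 < e -> exists2 y, positive_op y & opnorm (x - y) <= e) ->
  positive_op x.
Proof.
(* In [R[i]], [0 <= z] includes that [z] is real, so self-adjointness of the limit has to come
   first. *)
move=> h; have xs : selfadjoint x.
  apply: is_adjoint_closed => e e0; have [y y0 xy] := h e e0.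
  by exists y, y; split=> //; exact: positive_selfadjoint.
move=> u; have zr := selfadjoint_dot_real u xs.
have nv : '<u, u> = (complex.Re '<u, u>)%:C.
  by rewrite RRe_real ?ger0_real ?dot_ge0.
have ze : '<x u, u> = (complex.Re '<x u, u>)%:C by rewrite RRe_real.
have v0 : 0 <= complex.Re '<u, u> by exact/Re_ge0/dot_ge0.
have K0 : 0 < complex.Re '<u, u> + 1 by rewrite ltr_wpDl.
rewrite ze lecR; apply/ler_addgt0Pr => e e0.
have [y y0 xy] := h _ (divr_gt0 e0 K0).
rewrite -lecR rmorphD/= -ze.
have -> : '<x u, u> = '<y u, u> - - '<(x - y) u, u>.
  by rewrite bopB dotBl; ring.
rewrite -addrA addr_ge0 ?y0// addrC subr_ge0.
rewrite (le_trans (real_ler_norm _))//; last first.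
  rewrite normrN (le_trans (dot_opnorm _ _))//.
  rewrite nv -rmorphM lecR (le_trans (ler_wpM2r v0 xy))// mulrAC.
  by rewrite ler_pdivrMr// ler_wpM2l ?(ltW e0)// lerDl.
rewrite realN bopB dotBl realB// ger0_real// y0.
Qed.

End OperatorLimits.

(** * Generated C*-algebras and their unitization *)

Section CstarAlgebra.
Variables (R : realType) (H : hilbertType R).
Implicit Types (x y a : bop H) (A S : set (bop H)) (l : R[i]).

Lemma opnorm_scalar l : (opnorm (scalar_op l : bop H))%:C <= `|l|.
Proof. by rewrite opnormZ ler_piMr// lecR opnorm1. Qed.

(** With exponent [n.+2], two consecutive errors add up to at most [2^-1 ^+ n.+1], which is the
    increment of [geom_sum]. *)
Lemma approx_sequence S x : closure S x ->
  exists u : nat -> bop H, (forall n, S (u n)) /\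
    forall n, opnorm (x - u n) <= 2^-1 ^+ n.+2.
Proof.
move=> /closureP_op Sx.
have /choice[u uP] n : exists y, S y /\ opnorm (x - y) <= 2^-1 ^+ n.+2.
  have [|y Sy xy] := Sx (2^-1 ^+ n.+2); last by exists y.
  by rewrite exprn_gt0// invr_gt0.
by exists u; split=> n; case: (uP n).
Qed.

Lemma approx_sequence_step (u : nat -> bop H) x :
  (forall n, opnorm (x - u n) <= 2^-1 ^+ n.+2) ->
  forall n, opnorm (u n.+1 - u n) <= geom_sum R n.+1 - geom_sum R n.
Proof.
move=> xu n; rewrite geom_sumS.
have -> : u n.+1 - u n = (x - u n) - (x - u n.+1).
  by rewrite opprB [RHS]addrC addrA subrK.
rewrite (le_trans (opnormDr _ _))// opnormN (le_trans (lerD (xu _) (xu _)))//.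
have p0 : 0 <= 2^-1 ^+ n.+1 :> R by rewrite exprn_ge0// invr_ge0.
by rewrite (exprS _ n.+2) (exprS _ n.+1); lra.
Qed.

(** This supplies adjoints in [generated_cstar S] without the Riesz representation theorem: a
    star-closed [S] consists of adjointable operators, hence so does the algebra it generates. The
    set is closed because taking adjoints does not increase the norm, so the adjoints of an
    approximating sequence converge too. *)
Lemma adjointable_cstar : cstar_algebra [set x : bop H | exists y, is_adjoint x y].
Proof.
split; first split.
- split=> [|l x y [x' xx'] [y' yy']]; first by exists 0; exact: is_adjoint0.
  by exists (Num.conj l *: x' + y'); exact: is_adjoint_lin.
- by move=> x [y xy]; exists y => //; exists x; exact: is_adjoint_sym.
- by move=> x y [x' xx'] [y' yy']; exists (y' * x'); exact: is_adjointM.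
- move=> x /approx_sequence[u [/choice[w uw] xu]].
  have [||//|z zw] := @bop_complete R H w (geom_sum R) 1.
  - move=> n; apply: le_trans (approx_sequence_step xu n).
    by apply: opnorm_adjoint; apply: is_adjointD => //; exact: is_adjointN.
  - exact: geom_sum_le1.
  - exact: geom_sum_sup.
  exists z; apply: is_adjoint_closed => e e0.
  have [n ne] := geom_sum_sup e0; exists (u n), (w n); split=> //.
    rewrite (le_trans (xu n))// (le_trans _ ne)// /geom_sum opprB addrC subrK.
    apply: ler_wiXn2l; rewrite ?invr_ge0 ?invf_le1 ?ler1n//.
    by rewrite -addn2 leq_addr.
  exact: le_trans (zw n) ne.
Qed.

Lemma sub_generated_cstar S : S `<=` generated_cstar S.
Proof. exact: sub_gen_smallest. Qed.

Lemma generated_cstar_min S A : cstar_algebra A -> S `<=` A ->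
  generated_cstar S `<=` A.
Proof. by move=> cA SA; exact: smallest_sub. Qed.

Lemma generated_cstarP S : star_closed S -> cstar_algebra (generated_cstar S).
Proof.
move=> Sstar; have adj x : generated_cstar S x -> exists y, is_adjoint x y.
  apply: generated_cstar_min adjointable_cstar _ x => x /Sstar[y _ xy].
  by exists y.
split; first split.
- split=> [A [[[[]]]]//|l x y Sx Sy A AS].
  by have [[[[_ h] _] _ _] _] := AS; apply: h; [exact: Sx|exact: Sy].
- move=> x Sx; have [y xy] := adj x Sx; exists y => // A AS.
  have [[[_ h] _ _] _] := AS; have [z Az xz] := h x (Sx A AS).
  by rewrite (is_adjoint_inj xy xz).
- move=> x y Sx Sy A AS; have [[_ h _] _] := AS.
  by apply: h; [exact: Sx|exact: Sy].
- by apply: closed_bigI => A [[]].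
Qed.

Section Closure.
Variable A : set (bop H).
Hypothesis cA : cstar_algebra A.

Lemma cstar0 : A 0.
Proof. by case: cA => [[[]]]. Qed.

Lemma cstar_lin l x y : A x -> A y -> A (l *: x + y).
Proof. by case: cA => [[[_ +]]] _ _ _; apply. Qed.

Lemma cstarM x y : A x -> A y -> A (x * y).
Proof. by case: cA => [_ + _]; apply. Qed.

Lemma cstarD x y : A x -> A y -> A (x + y).
Proof. by move=> Ax Ay; rewrite -[x]scale1r; exact: cstar_lin. Qed.

Lemma cstarZ l x : A x -> A (l *: x).
Proof. by move=> Ax; rewrite -[_ *: _]addr0; exact: cstar_lin cstar0. Qed.

Lemma cstarB x y : A x -> A y -> A (x - y).
Proof. by move=> Ax Ay; rewrite addrC -scaleN1r; exact: cstar_lin. Qed.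

Lemma cstar_adj x : A x -> exists2 y, A y & is_adjoint x y.
Proof. by case: cA => [[_ +] _ _]; apply. Qed.

Lemma cstar_closed : closed A.
Proof. by case: cA. Qed.

(* [(1 + x) ^ n = 1 - a n] with [a n] in [A], and the left side tends to 0. *)
Lemma cstar_contains1 x : A x -> opnorm (1 + x) < 1 -> A 1.
Proof.
move=> Ax; set q := opnorm _ => q1.
have q0 : 0 <= q := opnorm_ge0 _.
have aP n : exists2 a, A a & opnorm (1 - a) <= q ^+ n.
  elim: n => [|n [a Aa an]].
    by exists 0; [exact: cstar0|rewrite subr0 opnorm1].
  exists (a - x + x * a); first by apply: cstarD; [exact: cstarB|exact: cstarM].
  have -> : 1 - (a - x + x * a) = (1 + x) * (1 - a).
    by rewrite mulrBr mulr1 mulrDl mul1r !opprD opprK !addrA [1 - a + x]addrAC.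
  by rewrite (le_trans (opnormM _ _))// exprS ler_wpM2l.
apply: closed_op cstar_closed _ => e e0.
have : (q ^+ n) @[n --> \oo] --> (0 : R) by apply: cvg_expr; rewrite ger0_norm.
move=> /cvgrPdist_le/(_ e e0)[n _ /(_ n (leqnn n))].
rewrite sub0r normrN => qn; have [a Aa an] := aP n; exists a => //.
by rewrite (le_trans an)// (le_trans (ler_norm _) qn).
Qed.

Hypothesis nuA : ~ has_unit A.

Lemma nonunital_notin1 : ~ A 1.
Proof.
by move=> A1; apply: nuA; exists 1 => // x _; rewrite mul1r mulr1.
Qed.

Lemma infinity_coefE a l : A a -> infinity_coef A (a + scalar_op l) = l.
Proof.
move=> Aa; have := @pi_inftyE R H A a l cA nuA Aa.
move=> /(congr1 (fun f : bop (complex_line R) => f (1 : R[i]))).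
rewrite /pi_infty !scalar_opE => h.
by rewrite -[LHS]mulr1 -[RHS]mulr1; exact: h.
Qed.

(** Otherwise [l^-1 *: (a + scalar_op l)] is 1 plus an element of [A] and has norm below 1, which
    would put 1 into [A]. *)
Lemma infinity_coef_le a l : A a -> `|l| <= (opnorm (a + scalar_op l))%:C.
Proof.
move=> Aa; rewrite (@normr_ReE R (R[i])^o) lecR leNgt; apply/negP => al.
have l0 : l != 0.
  apply: contraPneq al => ->; rewrite normr0 /=; apply/negP.
  by rewrite -leNgt opnorm_ge0.
apply: nonunital_notin1; apply: (@cstar_contains1 (l^-1 *: a)).
  exact: cstarZ.
have -> : 1 + l^-1 *: a = l^-1 *: (a + scalar_op l).
  by rewrite scalerDr scalerA mulVf// scale1r addrC.
rewrite -ltcR opnormZ normfV -ltr_pdivlMl ?invr_gt0 ?normr_gt0// invrK mulr1.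
by rewrite (@normr_ReE R (R[i])^o l) ltcR.
Qed.

Lemma adjoin_unit_cstar : cstar_algebra (adjoin_unit A).
Proof.
have scalar_lin (k l m : R[i]) :
    k *: scalar_op l + scalar_op m = scalar_op (k * l + m) :> bop H.
  by rewrite /scalar_op scalerA scalerDl.
split; first split.
- split=> [|k _ _ [a Aa [l ->]] [b Ab [m ->]]].
    exists 0; first exact: cstar0.
    by exists 0; rewrite /scalar_op scale0r addr0.
  exists (k *: a + b); first exact: cstar_lin.
  by exists (k * l + m); rewrite -scalar_lin scalerDr addrACA.
- move=> _ [a Aa [l ->]]; have [b Ab ab] := cstar_adj Aa.
  exists (b + scalar_op (Num.conj l)).
    by exists b => //; exists (Num.conj l).
  by apply: is_adjointD => //; apply: is_adjointZ; exact: selfadjoint1.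
- move=> _ _ [a Aa [l ->]] [b Ab [m ->]].
  exists (a * b + m *: a + l *: b).
    by apply: cstarD; [apply: cstarD|]; [exact: cstarM|exact: cstarZ|exact: cstarZ].
  exists (l * m); rewrite mulrDr !mulrDl /scalar_op !bopZr !bopZl !mulr1 mul1r.
  by rewrite scalerA (mulrC m) -!addrA; congr (_ + _); rewrite addrCA.
(* Closedness: by [infinity_coef_le] the scalar parts [l n] inherit the rate of convergence of
   [t n], hence the parts [a n] converge as well, and their limit is in [A]. *)
- move=> x /approx_sequence[t [At xt]].
  have /choice[a /choice[l alP]] n : exists a l, A a /\ t n = a + scalar_op l.
    by have [a Aa [l ->]] := At n; exists a, l.
  have Aa n : A (a n) by case: (alP n).
  have tE n : t n = a n + scalar_op (l n) by case: (alP n).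
  have [n||e|m _ lm] :=
    @dominated_seq_cvg R (complex_line R) l (geom_sum R) 1.
  - have := approx_sequence_step xt n; rewrite -lecR; apply: le_trans.
    rewrite !tE opprD addrACA -scalerBl.
    exact: infinity_coef_le (cstarB (Aa _) (Aa _)).
  - exact: geom_sum_le1.
  - exact: geom_sum_sup.
  exists (x - scalar_op m); last by exists m; rewrite subrK.
  apply: closed_op cstar_closed _ => e e0.
  have e20 : 0 < e / 2 by rewrite divr_gt0.
  have [n ne] := geom_sum_sup e20; exists (a n) => //.
  have -> : x - scalar_op m - a n = (x - t n) - scalar_op (m - l n : R[i]).
    rewrite tE /scalar_op scalerBl !opprD opprK !addrA.
    by rewrite [RHS]addrAC subrK addrAC.
  apply: le_trans (opnormDr (x - t n) _) _.
  rewrite opnormN [leRHS]splitr; apply: lerD.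
    rewrite (le_trans (xt n))// (le_trans _ ne)// /geom_sum opprB addrC subrK.
    apply: ler_wiXn2l; rewrite ?invr_ge0 ?invf_le1 ?ler1n//.
    by rewrite -addn2 leq_addr.
  rewrite -lecR (le_trans (opnorm_scalar _))// (le_trans (lm n))// lecR.
  exact: ne.
Qed.

(** From [0 <= t <= c] the norm of [c - t] is at most [c], so [|c - l| <= c] by [infinity_coef_le],
    and a real [l] satisfying this is nonnegative. That [l] is real follows by comparing the
    coefficients of [t] and of its adjoint. *)
Lemma infinity_coef_ge0 a l : A a -> positive_op (a + scalar_op l) -> 0 <= l.
Proof.
move=> Aa; set t := a + scalar_op l => t0.
have lr : Num.conj l = l.
  have [b Ab ab] := cstar_adj Aa.
  have : t = b + scalar_op (Num.conj l).
    apply: (is_adjoint_inj (positive_selfadjoint t0)).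
    by apply: is_adjointD => //; apply: is_adjointZ; exact: selfadjoint1.
  by move=> /(congr1 (infinity_coef A)); rewrite !infinity_coefE.
pose c := opnorm t + 1; have c0 : 0 < c by rewrite ltr_wpDl ?opnorm_ge0.
have tc : positive_op (scalar_op c%:C - t).
  by apply: selfadjoint_le_opnorm; [exact: positive_selfadjoint|rewrite lerDl].
have tcc : opnorm (scalar_op c%:C - t) <= c.
  by apply: positive_le_opnorm => //; rewrite opprB addrC subrK.
have ANa : A (- a) by rewrite -scaleN1r; exact: cstarZ.
have := infinity_coef_le (c%:C - l) ANa.
have -> : - a + scalar_op (c%:C - l) = scalar_op c%:C - t.
  by rewrite /scalar_op scalerBl /t opprD addrCA.
move=> /le_trans h; have {}h : `|c%:C - l| <= c%:C by apply: h; rewrite lecR.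
have lR : l \is Num.real by apply/CrealP.
move: h; rewrite (distrC _ l) real_ler_distl ?complex_real//.
  by rewrite subrr => /andP[].
by rewrite realB// complex_real.
Qed.

End Closure.

Lemma sub_adjoin_unit S : S `<=` adjoin_unit S.
Proof.
by move=> x Sx; exists x => //; exists 0; rewrite /scalar_op scale0r addr0.
Qed.

Lemma adjoin_unit1 S : S 0 -> adjoin_unit S 1.
Proof. by exists 0 => //; exists 1; rewrite add0r /scalar_op scale1r. Qed.

Lemma generated_adjoin_unit S : S 0 -> star_closed S ->
  ~ has_unit (generated_cstar S) ->
  generated_cstar (adjoin_unit S) = adjoin_unit (generated_cstar S).
Proof.
move=> S0 Sst nuA; have Tst : star_closed (adjoin_unit S).
  move=> _ [s Ss [l ->]]; have [t St st] := Sst s Ss.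
  exists (t + scalar_op (Num.conj l)); first by exists t => //; exists (Num.conj l).
  by apply: is_adjointD => //; apply: is_adjointZ; exact: selfadjoint1.
have cT := generated_cstarP Tst.
apply/seteqP; split.
  have cT' := adjoin_unit_cstar (generated_cstarP Sst) nuA.
  apply: generated_cstar_min cT' _ => _ [s Ss [l ->]].
  by exists s; [exact: sub_generated_cstar|exists l].
have ST : S `<=` generated_cstar (adjoin_unit S).
  by move=> s Ss; apply: sub_generated_cstar; exact: sub_adjoin_unit.
have T1 : generated_cstar (adjoin_unit S) 1.
  by apply: sub_generated_cstar; exact: adjoin_unit1.
move=> _ [a /(generated_cstar_min cT ST) Ta [l ->]].
by rewrite addrC; exact: (cstar_lin cT l T1 Ta).
Qed.

End CstarAlgebra.

(** * Square roots of squares *)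

Section Modulus.
Variables (R : realType) (H : hilbertType R).
Implicit Types (x y z : bop H).

(* The value of [sqrt_iter] at [x = 0]. *)
Fixpoint sqrt_radius n : R :=
  if n is m.+1 then (1 + sqrt_radius m ^+ 2) / 2 else 0.

Lemma sqrt_radius_itv n : 0 <= sqrt_radius n <= 1.
Proof.
elim: n => [|n /andP[e0 e1]] /=; first by rewrite lexx ler01.
have s1 : sqrt_radius n ^+ 2 <= 1 by rewrite expr_le1.
rewrite divr_ge0 ?addr_ge0 ?sqr_ge0//= ler_pdivrMr// mul1r.
by rewrite [leRHS]mulr2n lerD.
Qed.

(** For [d = 1 - sqrt_radius n] the recursion reads [d := d - d ^ 2 / 2], so as long as [d > e] each
    step lowers [d] by more than [e ^ 2 / 2]. *)
Lemma sqrt_radius_sup (e : R) : 0 < e -> exists n, 1 - sqrt_radius n <= e.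
Proof.
move=> e0; apply/not_existsP => h.
have {}h n : e < 1 - sqrt_radius n by rewrite ltNge; apply/negP/h.
have dn n : 1 - sqrt_radius n <= 1 - n%:R * (e ^+ 2 / 2).
  elim: n => [|n ih] /=; first by rewrite mul0r !subr0.
  rewrite -[n.+1%:R]natr1 (mulrDl n%:R) mul1r.
  have : e ^+ 2 <= (1 - sqrt_radius n) ^+ 2.
    by rewrite ler_sqr ?nnegrE ?ltW// (lt_trans e0).
  move: ih; rewrite sqrrB expr1n mul1r; set t := n%:R * _.
  by move: (sqrt_radius n ^+ 2) (e ^+ 2) t => q E t; lra.
have e20 : 0 < e ^+ 2 / 2 by rewrite divr_gt0// exprn_gt0.
have := archi_boundP (ltW (_ : 0 < (e ^+ 2 / 2)^-1)).
rewrite invr_gt0 => /(_ e20); set n := Num.bound _ => en.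
have := le_trans (ltW (h n)) (dn n); apply/negP; rewrite -ltNge.
have : 1 < n%:R * (e ^+ 2 / 2) by rewrite -ltr_pdivrMr// div1r.
lra.
Qed.

(* With [z := 1 - y] this is [z := z - (z ^ 2 - x ^ 2) / 2], which converges
   to [|x|]. *)
Fixpoint sqrt_iter x n : bop H :=
  if n is m.+1 then 2^-1 *: (1 - x * x + sqrt_iter x m * sqrt_iter x m) else 0.

Lemma sqr_sub_factor x y : x * y = y * x -> (x + y) * (x - y) = x * x - y * y.
Proof. by move=> xy; rewrite mulrDl !mulrBr xy addrA subrK. Qed.

Lemma half_ge0 : 0 <= 2^-1 :> R[i].
Proof. by rewrite invr_ge0. Qed.

Section Iteration.
Variable x : bop H.
Hypotheses (xx : selfadjoint x) (x1 : opnorm x <= 1).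
Local Notation y := (sqrt_iter x).
Local Notation e := sqrt_radius.

Lemma sqrt_iter_comm n : y n * x = x * y n.
Proof.
elim: n => [|n ih] /=; first by rewrite mul0r mulr0.
rewrite bopZl bopZr mulrDl mulrDr mulrBl mulrBr mul1r mulr1 mulrA.
by rewrite -(mulrA (y n)) ih !mulrA ih.
Qed.

Lemma sqrt_iter_ge0 n : positive_op (y n).
Proof.
elim: n => [|n ih] /=; first exact: positive0.
apply: positiveZ half_ge0 _; apply: positiveD; first exact: positive_1sub_sqr.
by apply: positive_adjM; exact: positive_selfadjoint.
Qed.

(** The induction step is [1 - z - y n.+1 = ((1 - z) ^ 2 - y n ^ 2) / 2], which factors into
    commuting positive operators. It is meant for both [z = x] and [z = - x], so that the limit of
    [1 - y n] dominates both. *)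
Lemma sqrt_iter_le z n : z * z = x * x -> positive_op (1 - z) ->
  (forall k, y k * z = z * y k) -> positive_op (1 - z - y n).
Proof.
move=> zx z1 yz; elim: n => [|n ih] /=; first by rewrite subr0.
have w0 : positive_op (1 - z + y n).
  have -> : 1 - z + y n = (1 - z - y n) + (y n + y n) by rewrite addrA subrK.
  by apply: positiveD => //; apply: positiveD; exact: sqrt_iter_ge0.
have wy : (1 - z) * y n = y n * (1 - z).
  by rewrite mulrBl mulrBr mul1r mulr1 yz.
have -> : 1 - z - 2^-1 *: (1 - x * x + y n * y n) =
    2^-1 *: ((1 - z + y n) * (1 - z - y n)).
  rewrite sqr_sub_factor// -zx; apply: (scalerI (_ : 2 != 0 :> R[i])).
    by rewrite pnatr_eq0.
  rewrite scalerBr !scalerA mulfV ?pnatr_eq0// !scale1r scaler_nat mulr2n.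
  rewrite mulrBl mul1r mulrBr mulr1 opprD addrA; congr (_ - _).
  by rewrite -addrA !opprB; congr (_ + _); rewrite addrC addrA subrK.
apply: positiveZ half_ge0 _; apply: positive_mul_comm => //.
have := @sqr_sub_factor (1 - z) (- y n).
rewrite mulrN mulNr wy mulrNN opprK => /(_ erefl) ->.
by rewrite sqr_sub_factor.
Qed.

Lemma opnorm_sqrt_iter n : opnorm (y n) <= e n.
Proof.
elim: n => [|n ih] /=.
  by apply: opnorm_le => u _; rewrite bop0 normr0.
have e0 : 0 <= e n by case/andP: (sqrt_radius_itv n).
have h0 : 0 <= 2^-1 :> R by rewrite invr_ge0.
have -> : (2^-1 : R[i]) = (2^-1)%:C by rewrite fmorphV rmorph_nat.
rewrite opnormZr// mulrC ler_wpM2r// (le_trans (opnormDr _ _))// lerD//.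
  apply: positive_le_opnorm => //; first exact: positive_1sub_sqr.
  by rewrite /scalar_op scale1r opprB addrC subrK; exact: positive_adjM.
by rewrite (le_trans (opnormM _ _))// expr2 ler_pM// opnorm_ge0.
Qed.

(** The splitting [a ^ 2 - b ^ 2 = a (a - b) + (a - b) b] holds without commutation, and the same
    splitting of the scalar recursion matches the norm estimates term by term. *)
Lemma sqrt_iter_step n : opnorm (y n.+1 - y n) <= e n.+1 - e n.
Proof.
elim: n => [|n ih]; first by rewrite !subr0; exact: opnorm_sqrt_iter.
have h0 : 0 <= 2^-1 :> R by rewrite invr_ge0.
have h2 : (2^-1 : R[i]) = (2^-1)%:C by rewrite fmorphV rmorph_nat.
have e0 k : 0 <= e k by case/andP: (sqrt_radius_itv k).
have -> : y n.+2 - y n.+1 =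
    2^-1 *: (y n.+1 * (y n.+1 - y n) + (y n.+1 - y n) * y n).
  rewrite mulrBr mulrBl addrA subrK [LHS]/= -scalerBr; congr (_ *: _).
  by rewrite opprD addrACA subrr add0r.
rewrite h2 opnormZr// (le_trans (ler_wpM2l h0 (opnormDr _ _)))//.
have -> : e n.+2 - e n.+1 =
    2^-1 * (e n.+1 * (e n.+1 - e n) + (e n.+1 - e n) * e n).
  have E k : e k.+1 = (1 + e k ^+ 2) / 2 by [].
  by rewrite (E n.+1) {2}(E n); move: (e n) (e n.+1) => a b; field.
rewrite ler_wpM2l// lerD// (le_trans (opnormM _ _))// ler_pM ?opnorm_ge0//.
  exact: opnorm_sqrt_iter.
exact: opnorm_sqrt_iter.
Qed.

(** [y n] is a polynomial in [x * x] with constant term [e n]; removing this term leaves an element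
    of [A], even if 1 is not in [A]. *)
Lemma sqrt_iter_mem A n : cstar_algebra A -> A x ->
  A (scalar_op (e n)%:C - y n).
Proof.
move=> cA Ax; elim: n => [|n ih].
  by rewrite subr0 /scalar_op scale0r; exact: cstar0.
have [a Aa yE] : exists2 a, A a & y n = scalar_op (e n)%:C - a.
  by exists (scalar_op (e n)%:C - y n) => //; rewrite subKr.
have -> : scalar_op (e n.+1)%:C - y n.+1 =
    2^-1 *: (x * x + (2 * (e n)%:C) *: a - a * a).
  rewrite [y n.+1]/= yE.
  have -> : scalar_op (e n.+1)%:C =
      2^-1 *: ((1 : bop H) + ((e n)%:C ^+ 2) *: (1 : bop H)).
    rewrite -[X in X + _]scale1r -scalerDl scalerA /scalar_op; congr (_ *: _).
    by rewrite rmorphM rmorphD rmorphXn fmorphV rmorph_nat rmorph1/= mulrC.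
  rewrite -scalerBr; congr (_ *: _).
  rewrite /scalar_op mulrBl !mulrBr !bopZl !bopZr !(mul1r, mulr1) scalerA expr2.
  rewrite mulr_natl -scalerMnl mulr2n.
  rewrite opprD addrACA subKr. rewrite -[_ - _ *: a - _]addrA -opprD subKr.
  by rewrite !addrA.
apply: (cstarZ cA); apply: (cstarB cA); last exact: cstarM.
by apply: (cstarD cA); [exact: cstarM|exact: cstarZ].
Qed.

End Iteration.

(** Here [r] is [1 - l] for the limit [l] of the iteration. Since [sqrt_radius n] tends to 1, [r] is
    also the limit of the elements of [sqrt_iter_mem], hence in [A]. The equation [r ^ 2 = x ^ 2] is
    not established: the two inequalities suffice. *)
Lemma modulus_le1 A x : cstar_algebra A -> A x -> selfadjoint x ->
  opnorm x <= 1 ->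
  exists r, [/\ A r, positive_op (r - x), positive_op (r + x) & opnorm r <= 2].
Proof.
move=> cA Ax xx x1.
have e1 n : sqrt_radius n <= 1 by case/andP: (sqrt_radius_itv n).
have [l ly] := bop_complete (sqrt_iter_step xx x1) e1 sqrt_radius_sup.
have bound z : z * z = x * x -> selfadjoint z -> opnorm z <= 1 ->
    (forall k, sqrt_iter x k * z = z * sqrt_iter x k) ->
    positive_op (1 - l - z).
  move=> zx zz z1 zy; apply: positive_closed => d d0.
  have [n nd] := sqrt_radius_sup d0; exists (1 - z - sqrt_iter x n).
    apply: sqrt_iter_le => //.
    by have := selfadjoint_le_opnorm zz z1; rewrite /scalar_op scale1r.
  have -> : 1 - l - z - (1 - z - sqrt_iter x n) = - (l - sqrt_iter x n).
    by rewrite [1 - l - z]addrAC [RHS]opprB opprB [LHS]addrC addrA subrK.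
  by rewrite opnormN (le_trans (ly n)).
exists (1 - l); split.
- apply: closed_op (cstar_closed cA) _ => d d0.
  have [n nd] := sqrt_radius_sup (divr_gt0 d0 (ltr0n _ 2)).
  exists (scalar_op (sqrt_radius n)%:C - sqrt_iter x n).
    exact: sqrt_iter_mem.
  have -> : 1 - l - (scalar_op (sqrt_radius n)%:C - sqrt_iter x n) =
      scalar_op (1 - sqrt_radius n)%:C - (l - sqrt_iter x n).
    rewrite rmorphB rmorph1 /scalar_op scalerBl scale1r !opprB.
    by rewrite addrACA [RHS]addrACA; congr (_ + _); rewrite addrC.
  rewrite (le_trans (opnormDr _ _))// opnormN [leRHS]splitr; apply: lerD.
    rewrite -lecR (le_trans (opnorm_scalar _ _))//.
    by rewrite ger0_norm ?lecR ?subr_ge0.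
  exact: le_trans (ly n) nd.
- by apply: bound => // k; exact: sqrt_iter_comm.
- rewrite -[x in _ + x]opprK; apply: bound; rewrite ?mulrNN ?opnormN//.
    exact: is_adjointN.
  by move=> k; rewrite mulrN mulNr sqrt_iter_comm.
- have := ly 0%N; rewrite !subr0 => l1.
  by rewrite (le_trans (opnormDr _ _))// opnormN lerD// opnorm1.
Qed.

Lemma modulus A x : cstar_algebra A -> A x -> selfadjoint x ->
  exists r, [/\ A r, positive_op (r - x) & positive_op (r + x)].
Proof.
move=> cA Ax xx; pose c := opnorm x + 1.
have c0 : 0 < c by rewrite ltr_wpDl ?opnorm_ge0.
have cV0 : 0 <= c^-1 by rewrite invr_ge0 ltW.
have [|||r [Ar rx rx' _]] := @modulus_le1 A (c^-1%:C *: x) cA.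
- exact: cstarZ.
- exact: selfadjointZ.
- by rewrite opnormZr// mulrC ler_pdivrMr// mul1r lerDl.
exists (c%:C *: r); have xE : x = c%:C *: (c^-1%:C *: x).
  by rewrite scalerA -rmorphM mulfV ?gt_eqF// scale1r.
have c0' : 0 <= c%:C by rewrite lecR ltW.
split; first exact: cstarZ.
  by rewrite {1}xE -scalerBr; exact: positiveZ.
by rewrite {1}xE -scalerDr; exact: positiveZ.
Qed.

(** The sum of the [2^-1 ^+ n.+1 *: r n] dominates each of its terms. It serves twice: to contradict
    unboundedness of a positive functional, and to build a strictly positive element. *)
Lemma positive_series A (r : nat -> bop H) : cstar_algebra A ->
  (forall n, [/\ A (r n), positive_op (r n) & opnorm (r n) <= 1]) ->
  exists b, [/\ A b, positive_op b &
    forall n, positive_op (b - (2^-1 ^+ n.+1)%:C *: r n)].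
Proof.
move=> cA rP; pose u n := \sum_(k < n) (2^-1 ^+ k.+1)%:C *: r k.
have h0 k : 0 <= 2^-1 ^+ k :> R by rewrite exprn_ge0// invr_ge0.
have h0' k : 0 <= (2^-1 ^+ k)%:C :> R[i] by rewrite lecR.
have uS n : u n.+1 = u n + (2^-1 ^+ n.+1)%:C *: r n by rewrite /u big_ord_recr.
have [n||e|b bu] := @bop_complete R H u (geom_sum R) 1.
- rewrite uS addrC addKr geom_sumS opnormZr// ler_piMr//.
  by case: (rP n).
- exact: geom_sum_le1.
- exact: geom_sum_sup.
have Au n : A (u n).
  elim: n => [|n ih]; first by rewrite /u big_ord0; exact: cstar0.
  by rewrite uS; apply: cstarD => //; apply: cstarZ => //; case: (rP n).
have term_ge0 n : positive_op ((2^-1 ^+ n.+1)%:C *: r n).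
  by apply: positiveZ => //; case: (rP n).
have ge_term k n : (k < n)%N -> positive_op (u n - (2^-1 ^+ k.+1)%:C *: r k).
  elim: n => // n ih; rewrite ltnS leq_eqVlt uS => /predU1P[->|/ih kn].
    rewrite addrK; elim: n {ih} => [|n ih].
      by rewrite /u big_ord0; exact: positive0.
    by rewrite uS; exact: positiveD.
  by rewrite addrAC; exact: positiveD.
have bk k : positive_op (b - (2^-1 ^+ k.+1)%:C *: r k).
  apply: positive_closed => e e0; have [n ne] := geom_sum_sup e0.
  pose m := maxn n k.+1; exists (u m - (2^-1 ^+ k.+1)%:C *: r k).
    by apply: ge_term; rewrite leq_maxr.
  rewrite opprB addrA subrK (le_trans (bu m))// (le_trans _ ne)//.
  rewrite /geom_sum !opprB !(addrC 1) !subrK.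
  by apply: ler_wiXn2l; rewrite ?invr_ge0 ?invf_le1 ?ler1n ?leq_maxl.
exists b; split=> //.
  apply: closed_op (cstar_closed cA) _ => e e0; have [n ne] := geom_sum_sup e0.
  by exists (u n) => //; exact: le_trans (bu n) ne.
have -> : b = (b - (2^-1 ^+ 1)%:C *: r 0%N) + (2^-1 ^+ 1)%:C *: r 0%N.
  by rewrite subrK.
exact: positiveD.
Qed.

End Modulus.

(** * Positive functionals *)

Section PositiveFunctionals.
Variables (R : realType) (H : hilbertType R).
Implicit Types (x y : bop H) (A S : set (bop H)).

Lemma cartesian_decomposition S x : operator_space S -> S x ->
  exists a b, [/\ S a /\ S b, selfadjoint a /\ selfadjoint b,
    opnorm a <= opnorm x /\ opnorm b <= opnorm x & x = a + 'i *: b].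
Proof.
move=> [[S0 Slin] Sst] Sx; have [y Sy xy] := Sst x Sx.
have yx := is_adjoint_sym xy; have xyn := opnorm_adjoint xy.
have SZ k z : S z -> S (k *: z) by move=> Sz; rewrite -[_ *: _]addr0; exact: Slin.
have i2 : 'i * 'i = -1 :> R[i] by rewrite -expr2 sqrCi.
have halfE : (2^-1 : R[i]) = (2^-1)%:C by rewrite fmorphV rmorph_nat.
have normh (k : R[i]) z : `|k| = 1 -> opnorm z <= opnorm x ->
    opnorm (2^-1 *: (k *: z + x)) <= opnorm x.
  move=> k1 zx; rewrite halfE opnormZr ?invr_ge0// ler_pdivrMl//.
  rewrite (le_trans (opnormDr _ _))// mulr_natl mulr2n lerD//.
  by rewrite -lecR opnormZ k1 mul1r lecR.
(* The factors [1 *:] give [a] and [b] the shape [k *: z + t] that [Slin] and [is_adjoint_lin]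
   expect. *)
pose a := 2^-1 *: (1 *: y + x); pose b := 2^-1 *: (1 *: ('i *: y) + - 'i *: x).
have conjh : Num.conj (2^-1 : R[i]) = 2^-1 by rewrite halfE conj_real.
exists a, b; split.
- split; first by apply/SZ/Slin.
  by apply/SZ/Slin; exact: SZ.
- split.
    have : is_adjoint a (Num.conj 2^-1 *: (Num.conj 1 *: x + y)).
      by apply: is_adjointZ; exact: is_adjoint_lin.
    by rewrite /selfadjoint conjh rmorph1 /a !scale1r addrC.
  have : is_adjoint b (Num.conj 2^-1 *: (Num.conj 1 *: (Num.conj 'i *: x) +
      Num.conj (- 'i) *: y)).
    apply: is_adjointZ; apply: is_adjoint_lin; first exact: is_adjointZ.
    exact: is_adjointZ.
  have ci : Num.conj (- 'i) = 'i :> R[i] by rewrite rmorphN /= conjCi opprK.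
  by rewrite ci conjCi conjh rmorph1 !scale1r addrC /selfadjoint /b scale1r.
- split; first by apply: normh => //; rewrite normr1.
  rewrite /b; have -> : 2^-1 *: (1 *: ('i *: y) + - 'i *: x) =
     (- 'i) *: (2^-1 *: ((-1) *: y + x)).
    rewrite scale1r !scalerA (mulrC _ 2^-1) -scalerA; congr (_ *: _).
    rewrite scalerDr scalerA. by rewrite mulrN1 opprK.
  by rewrite -lecR opnormZ normrN normCi mul1r lecR; apply: normh; rewrite ?normrN1.
rewrite /a /b scale1r scale1r scalerA (mulrC _ 2^-1) -scalerA -scalerDr.
have -> : 'i *: ('i *: y + - 'i *: x) = x - y.
  by rewrite scalerDr !scalerA mulrN i2 opprK scale1r scaleN1r addrC.
rewrite addrC addrA subrK -(mulr2n x) -(scaler_nat 2 x) scalerA mulVf ?pnatr_eq0//.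
by rewrite scale1r.
Qed.

Section Functional.
Variables (A : set (bop H)) (f : bop H -> R[i]).
Hypotheses (cA : cstar_algebra A) (fpos : positive_functional A f).

Lemma functional_lin (k : R[i]) x y : A x -> A y -> f (k *: x + y) = k * f x + f y.
Proof. by case: fpos => flin _; exact: flin. Qed.

Lemma functional_ge0 x : A x -> positive_op x -> 0 <= f x.
Proof. by case: fpos => _; apply. Qed.

Lemma functionalD x y : A x -> A y -> f (x + y) = f x + f y.
Proof. by move=> Ax Ay; rewrite -[x]scale1r functional_lin// mul1r scale1r. Qed.

Lemma functional0 : f 0 = 0.
Proof.
have A0 := cstar0 cA; apply: (addrI (f 0)).
by rewrite addr0 -functionalD// addr0.
Qed.

Lemma functionalZ (k : R[i]) x : A x -> f (k *: x) = k * f x.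
Proof.
move=> Ax; have A0 := cstar0 cA.
by rewrite -[_ *: _]addr0 functional_lin// functional0 addr0.
Qed.

Lemma functionalB x y : A x -> A y -> f (x - y) = f x - f y.
Proof.
by move=> Ax Ay; rewrite addrC -scaleN1r functional_lin// mulN1r addrC.
Qed.

Lemma functional_le x y : A x -> A y -> positive_op (y - x) -> f x <= f y.
Proof.
move=> Ax Ay xy; rewrite -subr_ge0 -functionalB//.
by apply: functional_ge0 => //; exact: cstarB.
Qed.

Lemma functional_modulus_le x r : A x -> A r -> positive_op (r - x) ->
  positive_op (r + x) -> `|f x| <= f r.
Proof.
move=> Ax Ar rx rx'; have h1 := functional_le Ax Ar rx.
have h2 : 0 <= f r + f x.
  by rewrite -functionalD//; apply: functional_ge0 => //; exact: cstarD.
have xr : f x \is Num.real.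
  have h3 : 0 <= f r - f x by rewrite subr_ge0.
  have -> : f x = (f r + f x - (f r - f x)) * 2^-1 by field.
  by apply: realM; [apply: realB; exact: ger0_real|exact: (ger0_real (half_ge0 R))].
by rewrite real_ler_norml// h1 -subr_ge0 opprK addrC h2.
Qed.

(* If [f] is unbounded on self-adjoint [x n] in the unit ball, then it would be
   infinite at a norm convergent series of multiples of the moduli of the
   [x n]. *)
Lemma functional_bounded_sa : exists2 M : R, 0 <= M &
  forall x, A x -> selfadjoint x -> `|f x| <= (M * opnorm x)%:C.
Proof.
apply: contrapT => h.
(* The growth [4 ^+ n] beats the weight [2^-1 ^+ n.+1] of the series and the factor [2^-1] that
   brings the norm of [r n] down to 1: the value at the sum is at least [2 ^ n / 4], hence at least
   [n / 4], for every [n]. *)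
have /choice[x xP] n : exists x, [/\ A x, selfadjoint x, opnorm x <= 1 &
    ((4 ^+ n)%:C : R[i]) <= `|f x|].
  have p4 : 0 <= 4 ^+ n :> R by rewrite exprn_ge0.
  apply: contrapT => hx; apply: h; exists (4 ^+ n) => // x Ax xx.
  have [x0|x0] := eqVneq (opnorm x) 0.
    by rewrite (opnorm_eq0 (_ : (opnorm x)%:C = 0)) ?x0// functional0 normr0
      lecR mulr_ge0// opnorm_ge0.
  have nx : 0 < opnorm x by rewrite lt0r x0 opnorm_ge0.
  have nx' : 0 < (opnorm x)%:C by rewrite ltcR.
  have nV : 0 <= (opnorm x)^-1 by rewrite invr_ge0 ltW.
  apply: contrapT => lx; apply: hx; exists ((opnorm x)^-1%:C *: x).
  split; first exact: cstarZ.
  - exact: selfadjointZ.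
  - by rewrite opnormZr// mulVf.
  - rewrite functionalZ// normrM ger0_norm ?lecR// fmorphV mulrC.
    rewrite ler_pdivlMr// -rmorphM/=.
    have : (4 ^+ n * opnorm x)%:C < `|f x|.
      by rewrite (@normr_ReE R (R[i])^o) ltcR ltNge -lecR
        -(@normr_ReE R (R[i])^o); apply/negP.
    exact: ltW.
have /choice[r rP] n := let: And4 Ax xx x1 _ := xP n in modulus_le1 cA Ax xx x1.
pose s n := 2^-1 *: r n.
have h20 : 0 <= 2^-1 :> R by rewrite invr_ge0.
have h2E : (2^-1 : R[i]) = (2^-1)%:C by rewrite fmorphV rmorph_nat.
have r0 n : positive_op (r n).
  have [_ rx rx' _] := rP n.
  have -> : r n = 2^-1 *: ((r n - x n) + (r n + x n)).
    rewrite addrACA addNr addr0 -(mulr2n (r n)) -(scaler_nat 2 (r n)) scalerA.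
    by rewrite mulVf ?scale1r.
  by apply: positiveZ (half_ge0 R) _; exact: positiveD.
have [n|b [Ab b0 bs]] := @positive_series R H A s cA.
  have [Ar _ _ r2] := rP n; split.
  - exact: cstarZ.
  - exact: positiveZ (half_ge0 R) _.
  - by rewrite /s h2E opnormZr// ler_pdivrMl// mulr1.
apply: (@complex_archimedean R (2^-1 * 2^-1) (f b)).
  by rewrite mulr_gt0// invr_gt0.
move=> n; have [Ar rx rx' _] := rP n; have [Ax _ _ x4] := xP n.
have As : A (s n) by exact: cstarZ.
apply: le_trans (functional_le (cstarZ cA _ As) Ab (bs n)).
rewrite functionalZ// /s functionalZ//.
apply: le_trans (_ : (2^-1 ^+ n.+1)%:C * (2^-1 * (4 ^+ n)%:C) <= _); last first.
  apply: ler_wpM2l; first by rewrite lecR exprn_ge0.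
  apply: ler_wpM2l; first exact: half_ge0.
  by apply: le_trans x4 _; exact: functional_modulus_le.
rewrite h2E -!rmorphM/= -(rmorph_nat (@real_complex R)) -rmorphM lecR.
rewrite exprS mulrACA -(mulrC (2^-1 * 2^-1)); apply: ler_wpM2l.
  by rewrite mulr_ge0.
rewrite -exprMn; have -> : 2^-1 * 4 = 2 :> R by lra.
by rewrite -natrX ler_nat ltnW// ltn_expl.
Qed.

Lemma functional_bounded : exists2 M : R, 0 <= M &
  forall x, A x -> `|f x| <= (M * opnorm x)%:C.
Proof.
have [M M0 fM] := functional_bounded_sa; exists (M + M) => [|x Ax].
  exact: addr_ge0.
have [opA _ _] := cA.
have [a [b [[Aa Ab] [aa bb] [ax bx] xE]]] := cartesian_decomposition opA Ax.
rewrite [X in f X]xE functionalD ?functionalZ//; last exact: cstarZ.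
rewrite (le_trans (ler_normD _ _))// normrM normCi mul1r mulrDl rmorphD.
apply: lerD.
  by rewrite (le_trans (fM a Aa aa))// lecR ler_wpM2l.
by rewrite (le_trans (fM b Ab bb))// lecR ler_wpM2l.
Qed.

(** The degenerate case of the Cauchy-Schwarz inequality for the form given by [f]. As [f] vanishes
    at [z * x], its value at the square of [t c x + w], with [w] the adjoint of [y], is affine in
    the real number [t]; being nonnegative, it has slope 0. The choices [c = 1] and [c = 'i]
    separate the two terms of the slope. *)
Lemma functional_adjM_eq0 x y : A x -> A y ->
  (exists2 z, is_adjoint x z & f (z * x) = 0) -> f (y * x) = 0.
Proof.
move=> Ax Ay [z xz fzx]; have [w Aw yw] := cstar_adj cA Ay.
have Az : A z by have [z' Az' /(is_adjoint_inj xz) ->] := cstar_adj cA Ax.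
have key (c : R[i]) : Num.conj c * f (z * w) + c * f (y * x) = 0.
  set q := _ + _.
  have tq (t : R) : 0 <= t%:C * q + f (y * w).
    pose v := (t%:C * c) *: x + w; pose v' := (Num.conj (t%:C * c)) *: z + y.
    have vv' : is_adjoint v v'.
      by apply: is_adjoint_lin => //; exact: is_adjoint_sym.
    have Av : A v by exact: cstar_lin.
    have Av' : A v' by exact: cstar_lin.
    have := functional_ge0 (cstarM cA Av' Av) (positive_adjM vv').
    rewrite /v /v' mulrDl !mulrDr !bopZl !bopZr.
    rewrite !(functionalD, functionalZ) ?fzx; try by
      repeat (apply: (cstarD cA) || apply: (cstarZ cA) || apply: (cstarM cA)).
    rewrite rmorphM /= conj_real !mulr0 add0r addrA !mulrA.
    by [].
  have q0 := tq 0; rewrite mul0r add0r in q0.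
  have qr : q \is Num.real.
    have := realB (ger0_real (tq 1)) (ger0_real q0).
    by rewrite rmorph1 mul1r addrK.
  have [ql|ql|//] := real_ltgtP qr (real0 _).
    exfalso; apply: (@complex_archimedean R (- q) (f (y * w))).
      by rewrite oppr_gt0.
    move=> n; have := tq n%:R; rewrite rmorph_nat => h.
    by rewrite mulrN -subr_ge0 opprK addrC.
  exfalso; apply: (@complex_archimedean R q (f (y * w))) => // n.
  by have := tq (- n%:R); rewrite rmorphN rmorph_nat mulNr addrC subr_ge0.
have k1 := key 1; have ki := key 'i.
rewrite rmorph1 !mul1r in k1; rewrite conjCi mulNr addrC in ki.
move: ki => /eqP; rewrite subr_eq0 => /eqP/(mulfI (neq0Ci _)) ki.
move: k1; rewrite -ki -mulr2n => /eqP; rewrite mulrn_eq0/= => /eqP.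
by [].
Qed.

End Functional.

End PositiveFunctionals.

(** * Strictly positive elements of separably generated algebras *)

Section StrictlyPositive.
Variables (R : realType) (H : hilbertType R).
Implicit Types (x y d : bop H) (A S : set (bop H)).

(** Since [A] need not contain 1, [f d = 0] is not a special case of [f (y * d) = 0]: the moduli [r]
    and [s] of the two parts of [d] yield the former, the summand [d' * d] the latter. *)
Lemma dominating_element A d : cstar_algebra A -> A d ->
  exists q, [/\ A q, positive_op q & forall f, positive_functional A f ->
    f q = 0 -> f d = 0 /\ forall y, A y -> f (y * d) = 0].
Proof.
move=> cA Ad; have [opA _ _] := cA.
have [a [b [[Aa Ab] [aa bb] _ dE]]] := cartesian_decomposition opA Ad.
have [d' Ad' dd'] := cstar_adj cA Ad.
have [r [Ar ra ra']] := modulus cA Aa aa.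
have [s [As sb sb']] := modulus cA Ab bb.
have Add : A (d' * d) by exact: (cstarM cA).
have pos r0 x0 : positive_op (r0 - x0) -> positive_op (r0 + x0) ->
    positive_op (r0 : bop H).
  move=> h1 h2; have -> : r0 = 2^-1 *: ((r0 - x0) + (r0 + x0)).
    rewrite addrACA addNr addr0 -(mulr2n r0) -(scaler_nat 2 r0) scalerA.
    by rewrite mulVf ?scale1r.
  by apply: positiveZ (half_ge0 R) _; exact: positiveD.
have r0 := pos _ _ ra ra'; have s0 := pos _ _ sb sb'.
exists (r + s + d' * d); split.
- by apply: (cstarD cA) => //; exact: cstarD.
- by apply: positiveD; [exact: positiveD|exact: positive_adjM].
move=> f fpos; rewrite !(functionalD fpos)//; last exact: cstarD.
have fr := functional_ge0 fpos Ar r0; have fs := functional_ge0 fpos As s0.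
have fd := functional_ge0 fpos Add (positive_adjM dd').
move/eqP; rewrite paddr_eq0 ?addr_ge0// paddr_eq0//.
move=> /andP[/andP[/eqP fr0 /eqP fs0] /eqP fd0].
split; last first.
  by move=> y Ay; apply: (functional_adjM_eq0 cA fpos Ad Ay); exists d'.
have fa : f a = 0.
  apply/eqP; rewrite -normr_le0 -fr0.
  exact: (functional_modulus_le cA fpos Aa Ar).
have fb : f b = 0.
  apply/eqP; rewrite -normr_le0 -fs0.
  exact: (functional_modulus_le cA fpos Ab As).
rewrite dE (functionalD fpos)// ?(functionalZ cA fpos)//; last exact: cstarZ.
by rewrite fa fb mulr0 addr0.
Qed.

Lemma separable_sequence S : S 0 -> separable_set S ->
  exists d : nat -> bop H, (forall n, S (d n)) /\ S `<=` closure (range d).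
Proof.
move=> S0 [D [/countable_injP[g ginj] DS SD]].
(* [g] need not be onto; at the remaining indices [d] takes the default value 0, which lies in
   [S]. *)
pose d n := xget 0 [set x | D x /\ g x = n].
exists d; split=> [n|x /SD]; last first.
  apply: closure_subset => {}x Dx; exists (g x) => //.
  rewrite /d; case: xgetP => [y _ [Dy gy]|/(_ x) h]; last by exfalso; exact: h.
  by apply: ginj; rewrite ?inE.
by rewrite /d; case: xgetP => [x _ [Dx _]|//]; exact: DS.
Qed.

(* The elements [x] with [f x = 0] and [f (y * x) = 0] for all [y] form a closed
   left ideal containing [S], whose intersection with its adjoint is a
   C*-algebra. *)
Lemma functional_eq0_generated S (d : nat -> bop H) (f : bop H -> R[i]) :
  operator_space S -> S `<=` closure (range d) -> (forall n, S (d n)) ->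
  positive_functional (generated_cstar S) f ->
  (forall n, f (d n) = 0 /\ forall y, generated_cstar S y -> f (y * d n) = 0) ->
  forall x, generated_cstar S x -> f x = 0.
Proof.
move=> [[S0 Slin] Sst] Sd dS; have cA := generated_cstarP Sst.
have SA := @sub_generated_cstar R H S.
have minA C := @generated_cstar_min R H S C.
move: (generated_cstar S) cA SA minA => A cA SA minA fpos fd.
have [M M0 fM] := functional_bounded cA fpos.
pose B := [set x | [/\ A x, f x = 0 & forall y, A y -> f (y * x) = 0]].
have small (z : R[i]) (K : R) : 0 <= K ->
    (forall e : R, 0 < e -> `|z| <= (K * e)%:C) -> z = 0.
  move=> K0 h; apply/eqP; rewrite -normr_le0.
  apply: (@normr_le_eps R (R[i])^o _ 0) => e e0; rewrite add0r.
  have K1 : 0 < K + 1 by rewrite ltr_wpDl.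
  apply: le_trans (h _ (divr_gt0 e0 K1)) _.
  rewrite lecR mulrCA ler_piMr ?(ltW e0)//.
  by rewrite ler_pdivrMr// mul1r lerDl.
(* Closedness of [B] is where the bound [M] on [f] enters. *)
have Bcl x : (forall e : R, 0 < e -> exists2 y, B y & opnorm (x - y) <= e) -> B x.
  move=> h; have Ax : A x.
    apply: closed_op (cstar_closed cA) _ => e /h[y [Ay _ _] xy].
    by exists y.
  split=> // [|y Ay]; first apply: (small _ M M0) => e /h[z [Az fz _] xz].
    rewrite -[f x]subr0 -fz -(functionalB fpos)//.
    by rewrite (le_trans (fM _ (cstarB cA Ax Az)))// lecR ler_wpM2l.
  apply: (small _ (M * opnorm y)); first by rewrite mulr_ge0// opnorm_ge0.
  move=> e /h[z [Az _ fz] xz]; rewrite -[f _]subr0 -(fz y Ay).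
  have -> : f (y * x) - f (y * z) = f (y * (x - z)).
    by rewrite mulrBr (functionalB fpos)//; exact: (cstarM cA).
  rewrite (le_trans (fM _ (cstarM cA Ay (cstarB cA Ax Az))))// lecR -mulrA.
  rewrite ler_wpM2l// (le_trans (opnormM _ _))//.
  by rewrite ler_wpM2l// opnorm_ge0.
have Blin k x y : B x -> B y -> B (k *: x + y).
  move=> [Ax fx fx'] [Ay fy fy']; split; first exact: cstar_lin.
    by rewrite (functional_lin fpos)// fx fy mulr0 addr0.
  move=> z Az; rewrite mulrDr bopZr (functional_lin fpos)//; try exact: (cstarM cA).
  by rewrite fx'// fy'// mulr0 addr0.
have BM x y : A x -> B y -> B (x * y).
  move=> Ax [Ay fy fy']; split; first exact: (cstarM cA).
    exact: fy'.
  by move=> z Az; rewrite mulrA; apply: fy'; exact: (cstarM cA).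
have B0 : B 0.
  split; first exact: cstar0.
    exact: (functional0 cA fpos).
  by move=> y Ay; rewrite mulr0 (functional0 cA fpos).
have SB : S `<=` B.
  move=> x /Sd /closureP_op xd; apply: Bcl => e /xd[_ [n _ <-] xn].
  exists (d n) => //; have [fdn fdn'] := fd n.
  by split=> //; exact: SA.
have BA x : B x -> A x by case.
pose C := [set x | B x /\ exists2 y, B y & is_adjoint x y].
have cC : cstar_algebra C.
  split; first split.
  - split=> [|k x y [Bx [x' Bx' xx']] [By [y' By' yy']]].
      by split=> //; exists 0 => //; exact: is_adjoint0.
    split; first exact: Blin.
    by exists (Num.conj k *: x' + y'); [exact: Blin|exact: is_adjoint_lin].
  - move=> x [Bx [y By xy]]; exists y => //; split=> //.
    by exists x => //; exact: is_adjoint_sym.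
  - move=> x y [Bx [x' Bx' xx']] [By [y' By' yy']]; split.
      by apply: BM => //; exact: BA.
    exists (y' * x'); first by apply: BM => //; exact: BA.
    exact: is_adjointM.
  - move=> x /closureP_op xC.
    have Bx : B x by apply: Bcl => e /xC[y [By _] xy]; exists y.
    split=> //; have [x' Ax' xx'] := cstar_adj cA (BA _ Bx).
    exists x' => //; apply: Bcl => e /xC[y [By [y' By' yy']] xy].
    exists y' => //; apply: le_trans xy; apply: opnorm_adjoint.
    by apply: is_adjointD => //; exact: is_adjointN.
have SC : S `<=` C.
  by move=> x Sx; split; [exact: SB|have [y /SB By xy] := Sst x Sx; exists y].
by move=> x /(minA C cC SC)[[]].
Qed.

Lemma strictly_positive_exists S : operator_space S -> separable_set S ->
  exists p, strictly_positive (generated_cstar S) p.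
Proof.
move=> opS sepS; have [[S0 Slin] Sst] := opS.
have [d [dS Sd]] := separable_sequence S0 sepS.
have cA := generated_cstarP Sst.
have Ad n : generated_cstar S (d n) by exact: sub_generated_cstar.
have eq0 f := @functional_eq0_generated S d f opS Sd dS.
move: (generated_cstar S) cA Ad eq0 => A cA Ad eq0.
have /choice[q qP] n := dominating_element cA (Ad n).
pose c n := (opnorm (q n) + 1)^-1.
have c0 n : 0 < c n by rewrite invr_gt0 ltr_wpDl ?opnorm_ge0.
have c0' n : 0 < (c n)%:C by rewrite ltcR.
have [n|p [Ap p0 pq]] := @positive_series R H A (fun n => (c n)%:C *: q n) cA.
  have [Aq q0 _] := qP n; split; first exact: cstarZ.
    by apply: positiveZ => //; exact: ltW.
  rewrite opnormZr ?(ltW (c0 n))// ler_pdivrMl ?mulr1 ?lerDl//.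
  by rewrite ltr_wpDl ?opnorm_ge0.
exists p; split=> // f fpos fp.
apply: (eq0 f fpos) => n.
have [Aq q0 qf] := qP n; apply: qf => //.
have h0 : 0 < (2^-1 ^+ n.+1)%:C :> R[i] by rewrite ltcR exprn_gt0// invr_gt0.
have Acq : A ((c n)%:C *: q n) by exact: cstarZ.
have := functional_le cA fpos (cstarZ cA _ Acq) Ap (pq n).
rewrite !(functionalZ cA fpos)// fp pmulr_rle0// pmulr_rle0// => h.
by apply/eqP; rewrite eq_le h; exact: (functional_ge0 fpos).
Qed.

End StrictlyPositive.

(** * The Hahn-Banach theorem *)

Section HahnBanach.
Variables (R : realType) (V : lmodType R).
Implicit Types (p q : V -> R) (x y : V).

Definition sublinear p :=
  (forall x y, p (x + y) <= p x + p y) /\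
  (forall (a : R) x, 0 < a -> p (a *: x) = a * p x).

Lemma sublinear0 p : sublinear p -> p 0 = 0.
Proof.
move=> [_ hom]; have := hom 2 0 (ltr0n _ 2); rewrite scaler0; lra.
Qed.

Lemma sublinear_opp p x : sublinear p -> - p (- x) <= p x.
Proof.
move=> sp; have [sub _] := sp; have := sub x (- x).
by rewrite subrr (sublinear0 sp); lra.
Qed.

(** The common pattern of [slide], of the infimum of a chain, and of [infinity_bound]. Homogeneity
    only needs one inequality, which is applied to both [a] and [a^-1]. *)
Lemma sublinear_inf (P : V -> set R) : (forall x, has_inf (P x)) ->
  (forall x y s t, P x s -> P y t -> exists2 r, P (x + y) r & r <= s + t) ->
  (forall (a : R) x t, 0 < a -> P x t -> exists2 r, P (a *: x) r & r <= a * t) ->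
  sublinear (fun x => inf (P x)).
Proof.
move=> Pinf PD PZ; pose G x := inf (P x).
have G_le x t : P x t -> G x <= t by move=> Pt; exact: (inf_lbound (Pinf x).2).
have le_G x t : (forall r, P x r -> t <= r) -> t <= G x.
  by move=> tP; exact: (lb_le_inf (Pinf x).1).
have hom_le (a : R) x : 0 < a -> G (a *: x) <= a * G x.
  move=> a0; rewrite -ler_pdivrMl//; apply: (le_G _ _ _) => t Pt.
  have [r Pr rt] := PZ a x t a0 Pt.
  by rewrite ler_pdivrMl// (le_trans (G_le _ _ Pr)).
split=> [x y|a x a0].
  rewrite -[leLHS]/(G (x + y)) -[leRHS]/(G x + G y).
  rewrite -lerBlDr; apply: (le_G _ _ _) => s Ps; rewrite lerBlDr -lerBlDl.
  apply: (le_G _ _ _) => t Pt; have [r Pr rst] := PD x y s t Ps Pt.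
  by rewrite lerBlDl (le_trans (G_le _ _ Pr)).
rewrite -[LHS]/(G (a *: x)) -[RHS]/(a * G x).
apply/le_anti; rewrite hom_le//= -ler_pdivlMl//.
have aV0 : 0 < a^-1 by rewrite invr_gt0.
by have := hom_le a^-1 (a *: x) aV0; rewrite scalerA mulVf ?gt_eqF// scale1r.
Qed.

(* The largest sublinear minorant of [p] whose value at [- y] is at most
   [- p y]. *)
Definition slide p y x :=
  inf [set p (x + t *: y) - t * p y | t in [set t : R | 0 <= t]].

Lemma slideP p y : sublinear p -> [/\ sublinear (slide p y),
  forall x, slide p y x <= p x & slide p y (- y) <= - p y].
Proof.
move=> sp; have [sub hom] := sp.
have lb t x : 0 <= t -> - p (- x) <= p (x + t *: y) - t * p y.
  rewrite le_eqVlt => /predU1P[<-|t0].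
    by rewrite scale0r addr0 mul0r subr0 sublinear_opp.
  have := sub (x + t *: y) (- x); rewrite addrAC subrr add0r hom//; lra.
have slide_le x t : 0 <= t -> slide p y x <= p (x + t *: y) - t * p y.
  move=> t0; apply: inf_lbound; last by exists t.
  by exists (- p (- x)) => _ [s s0 <-]; exact: lb.
split.
- apply: sublinear_inf => [x|x x' _ _ [t t0 <-] [s s0 <-]|a x _ a0 [t t0 <-]].
  + split; first by exists (p (x + 0 *: y) - 0 * p y), 0 => /=.
    by exists (- p (- x)) => _ [t t0 <-]; exact: lb.
  + exists (p (x + x' + (t + s) *: y) - (t + s) * p y).
      by exists (t + s) => //; exact: addr_ge0.
    rewrite scalerDl addrACA mulrDl.
    by have := sub (x + t *: y) (x' + s *: y); lra.
  + exists (p (a *: x + (a * t) *: y) - (a * t) * p y).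
      by exists (a * t) => //; exact: mulr_ge0 (ltW a0) t0.
    by rewrite -scalerA -scalerDr hom// mulrBr mulrA.
- by move=> x; have := slide_le x 0 (lexx 0); rewrite scale0r addr0 mul0r subr0.
- have := slide_le (- y) 1 ler01.
  by rewrite scale1r addNr (sublinear0 sp) mul1r sub0r.
Qed.

Definition sublinear_below p := {q : V -> R | sublinear q /\ forall x, q x <= p x}.

(** Zorn's lemma for the reversed pointwise order. The pointwise infimum of a nonempty chain is
    finite, as every member is at least [- p (- x)], and subadditive, as two members can be replaced
    by the smaller one. The empty chain is bounded by [p] itself. *)
Lemma minimal_sublinear p : sublinear p -> exists q, [/\ sublinear q,
  forall x, q x <= p x &
  forall q', sublinear q' -> (forall x, q' x <= q x) -> q' = q].
Proof.
move=> sp; pose T := sublinear_below p.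
pose geT (s t : T) : bool := `[< forall x, sval t x <= sval s x >].
have [|||C Ctot|q qmin] := @Zorn T geT.
- by move=> t; apply/asboolP.
- move=> r s t /asboolP rs /asboolP st; apply/asboolP => x.
  exact: le_trans (st x) (rs x).
- move=> [s Ps] [t Pt] /asboolP/= st /asboolP/= ts.
  have e : s = t by apply/funext => x; apply/le_anti; rewrite st ts.
  by subst t; congr exist; exact: Prop_irrelevance.
- have [[c0 Cc0]|C0] := pselect (exists c, C c); last first.
    exists (exist _ p (conj sp (fun x => lexx (p x)))) => s Cs.
    by exfalso; apply: C0; exists s.
  pose F (c : {c : T | C c}) := sval (sval c).
  have sF c : sublinear (F c) by case: (svalP (sval c)).
  have Fp c x : F c x <= p x by case: (svalP (sval c)) => _; exact.
  have lbF c x : - p (- x) <= F c x.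
    by apply: le_trans (sublinear_opp x (sF c)); rewrite lerN2.
  have Fle (c d : {c : T | C c}) :
      (forall x, F c x <= F d x) \/ (forall x, F d x <= F c x).
    by have [/asboolP|/asboolP] := Ctot _ _ (svalP c) (svalP d); [right|left].
  pose i0 : {c : T | C c} := exist _ c0 Cc0.
  have inf_le c x : inf [set F i x | i in setT] <= F c x.
    apply: inf_lbound; last by exists c.
    by exists (- p (- x)) => _ [i _ <-].
  have sinf : sublinear (fun x => inf [set F i x | i in setT]).
    apply: sublinear_inf => [x|x y _ _ [c _ <-] [d _ <-]|a x _ a0 [c _ <-]].
    + split; first by exists (F i0 x), i0.
      by exists (- p (- x)) => _ [c _ <-]; exact: lbF.
    + have [cd|dc] := Fle c d.
        exists (F c (x + y)); first by exists c.
        by rewrite (le_trans ((sF c).1 x y))// lerD2l.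
      exists (F d (x + y)); first by exists d.
      by rewrite (le_trans ((sF d).1 x y))// lerD2r.
    + by exists (F c (a *: x)); [exists c|rewrite (sF c).2].
  have infp x : inf [set F i x | i in setT] <= p x.
    exact: le_trans (inf_le i0 x) (Fp i0 x).
  pose Q q := sublinear q /\ forall x, q x <= p x.
  exists (exist Q _ (conj sinf infp)) => s Cs; apply/asboolP => x /=.
  exact: (inf_le (exist _ s Cs)).
case: q qmin => q [sq qp] qmin; exists q; split=> // q' sq' q'q.
have q'p x : q' x <= p x by exact: le_trans (q'q x) (qp x).
pose Q q := sublinear q /\ forall x, q x <= p x.
have /qmin/(congr1 sval)//= :
    geT (exist Q q (conj sq qp)) (exist Q q' (conj sq' q'p)).
exact/asboolP.
Qed.

(** A minimal sublinear [F] equals each of its slides, so [F (- y) <= - F y], which makes it linear;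
    no extension from subspaces is needed. Starting below [slide p x0] instead of [p] forces the
    value at [x0]. *)
Lemma hahn_banach p x0 : sublinear p -> exists F : V -> R,
  [/\ linear_for *%R F, forall x, F x <= p x & F x0 = p x0].
Proof.
move=> sp; have [ss slp sly] := slideP x0 sp.
have [F [sF Fs Fmin]] := minimal_sublinear ss.
have Fslide y : slide F y = F.
  by have [sl slF _] := slideP y sF; exact: Fmin.
have FN y : F (- y) = - F y.
  apply/le_anti; rewrite -{1}(Fslide y); have [_ _ ->] := slideP y sF.
  by rewrite /= lerNl sublinear_opp.
have Fsub := sF.1; have FD x y : F (x + y) = F x + F y.
  apply/le_anti; rewrite Fsub/=; have := Fsub (- x) (- y).
  by rewrite -opprD !FN; lra.
have FZ (a : R) x : F (a *: x) = a * F x.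
  have [a0|a0|->] := ltgtP a 0; last by rewrite scale0r mul0r (sublinear0 sF).
    by rewrite -[a]opprK scaleNr FN sF.2 ?oppr_gt0// -mulNr.
  by rewrite sF.2.
exists F; split=> [a x y|x|]; first by rewrite FD FZ.
  exact: le_trans (Fs x) (slp x).
apply/le_anti; rewrite (le_trans (Fs x0) (slp x0))/=.
by have := le_trans (Fs (- x0)) sly; rewrite FN lerN2.
Qed.

End HahnBanach.

(** * States vanishing on S *)

Section RealScalars.
Variable R : realType.

(** Restriction of scalars to [R], under an alias so that the real module structure does not compete
    with the complex one. *)
Definition real_scalars (V : lmodType R[i]) : Type := V.

HB.instance Definition _ (V : lmodType R[i]) :=
  GRing.Zmodule.copy (real_scalars V) V.

Section Instance.
Variable V : lmodType R[i].
Let scale (a : R) (x : real_scalars V) : real_scalars V := a%:C *: (x : V).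

Let scaleA a b x : scale a (scale b x) = scale (a * b) x.
Proof. by rewrite /scale scalerA rmorphM. Qed.

Let scale1 : left_id 1 scale.
Proof. by move=> x; rewrite /scale rmorph1 scale1r. Qed.

Let scaleDr : right_distributive scale +%R.
Proof. by move=> a x y; rewrite /scale scalerDr. Qed.

Let scaleDl x : {morph scale^~ x : a b / a + b}.
Proof. by move=> a b; rewrite /scale rmorphD scalerDl. Qed.

HB.instance Definition _ := GRing.Zmodule_isLmodule.Build R (real_scalars V)
  scaleA scale1 scaleDr scaleDl.

Lemma real_scaleE (a : R) (x : real_scalars V) : a *: x = a%:C *: (x : V) :> V.
Proof. by []. Qed.

End Instance.
End RealScalars.

Section Infinity.
Variables (R : realType) (H : hilbertType R) (S : set (bop H)).
Hypotheses (opS : operator_space S) (nuA : ~ has_unit (generated_cstar S)).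
Local Notation A := (generated_cstar S).
Local Notation V := (real_scalars (bop H)).
Implicit Types (x y : bop H).

Let cA : cstar_algebra A.
Proof. by apply: generated_cstarP; case: opS. Qed.

Let S0 : S 0.
Proof. by case: opS => [[]]. Qed.

Let SA : S `<=` A.
Proof. exact: sub_generated_cstar. Qed.

Lemma nonneg_coef s (l : R) : S s -> positive_op (s + scalar_op l%:C) -> 0 <= l.
Proof. by move=> /SA As /(infinity_coef_ge0 cA nuA As); rewrite lecR. Qed.

(** For self-adjoint [y] the condition is [s + l >= y]. The real part keeps the set nonempty for
    every other [y], where the operator order would force self-adjointness. *)
Definition majorant y : set R := [set l | exists s, [/\ S s, selfadjoint s &
  forall u, 0 <= complex.Re '<(s + scalar_op l%:C - y) u, u> ]].

(** Adding [|y|] to both sides makes [s + (l + |y|)] positive, and its coefficient at infinity is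
    then nonnegative. Nonunitality is what keeps the infimum finite here. *)
Lemma majorant_ge y l : majorant y l -> - opnorm y <= l.
Proof.
move=> [s [Ss ss sy]]; rewrite -subr_ge0 opprK.
apply: (nonneg_coef Ss) => u.
have sa : selfadjoint (s + scalar_op (l + opnorm y)%:C).
  by apply: is_adjointD => //; exact: selfadjoint_scalar.
have zr := selfadjoint_dot_real u sa.
rewrite -(RRe_real zr) lecR.
have -> : s + scalar_op (l + opnorm y)%:C =
    (s + scalar_op l%:C - y) + (scalar_op (opnorm y)%:C + y).
  by rewrite rmorphD /scalar_op scalerDl addrACA addNr addr0 !addrA.
rewrite bopD dotDl raddfD; apply: addr_ge0; first exact: sy.
rewrite bopD scalar_opE dotDl dotZl raddfD/=.
have := dot_opnorm y u; rewrite -(ger0_norm (dot_ge0 u)).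
rewrite (ger0_norm (dot_ge0 u)) => h.
have : complex.Re (- '<y u, u>) <= complex.Re ((opnorm y)%:C * '<u, u>).
  have : `|complex.Re (- '<y u, u>) |%:C <= (opnorm y)%:C * '<u, u>.
    by apply: le_trans h; rewrite -[leRHS]normrN; exact: normc_ge_Re.
  by rewrite lecE => /andP[_]; apply: le_trans; exact: ler_norm.
by rewrite raddfN/= -subr_ge0 opprK.
Qed.

Lemma majorant_mem y s (l : R) : S s -> selfadjoint s ->
  positive_op (s + scalar_op l%:C - y) -> majorant y l.
Proof. by move=> Ss ss sy; exists s; split=> // u; exact: Re_ge0. Qed.

Lemma majorant_opnorm y : majorant y (opnorm y).
Proof.
exists 0; split=> // [|u]; first exact: is_adjoint0.
rewrite add0r bopB scalar_opE dotBl dotZl raddfB/= subr_ge0.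
have h := dot_opnorm y u.
have : `|complex.Re ('<y u, u>) |%:C <= (opnorm y)%:C * '<u, u>.
  by apply: le_trans h; exact: normc_ge_Re.
by rewrite lecE => /andP[_]; apply: le_trans; exact: ler_norm.
Qed.

Definition infinity_bound (y : V) : R := inf (majorant y).

Lemma has_inf_majorant y : has_inf (majorant y).
Proof.
split; first by exists (opnorm y); exact: majorant_opnorm.
by exists (- opnorm y) => l; exact: majorant_ge.
Qed.

Lemma infinity_bound_le y l : majorant y l -> infinity_bound y <= l.
Proof. by move=> yl; exact: (inf_lbound (has_inf_majorant y).2). Qed.

Lemma sublinear_infinity_bound : sublinear infinity_bound.
Proof.
have [[_ Slin] _] := opS; apply: (@sublinear_inf _ V majorant).
- exact: has_inf_majorant.
- move=> x y l m [s [Ss ss sx]] [t [St tt ty]]; exists (l + m) => //.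
  exists (s + t); split.
  + by rewrite -[s]scale1r; exact: Slin.
  + exact: is_adjointD.
  + move=> u; have -> : s + t + scalar_op (l + m)%:C - (x + y) =
        (s + scalar_op l%:C - x) + (t + scalar_op m%:C - y) :> bop H.
      rewrite rmorphD /scalar_op scalerDl opprD.
      by rewrite [in RHS]addrACA; congr (_ + _); rewrite addrACA.
    by rewrite bopD dotDl raddfD; apply: addr_ge0; [exact: sx|exact: ty].
- move=> a x l a0 [s [Ss ss sx]]; exists (a * l) => //.
  exists (a%:C *: s); split.
  + by rewrite -[_ *: _]addr0; exact: Slin.
  + exact: selfadjointZ.
  + move=> u; rewrite real_scaleE.
    have -> : a%:C *: s + scalar_op (a * l)%:C - a%:C *: x =
        a%:C *: (s + scalar_op l%:C - x).
      by rewrite scalerBr scalerDr rmorphM /scalar_op scalerA.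
    rewrite bopZ dotZl; move: (sx u); case: ('<_, _>) => p q /= p0.
    by rewrite mul0r subr0 mulr_ge0// ltW.
Qed.

(* The Hahn-Banach functional, complexified by [y => F y - i F (i y)]. *)
Lemma state_extension x : exists f : bop H -> R[i],
  [/\ linear_on (V := (R[i])^o) setT f, f 1 = 1,
      forall y, positive_op y -> 0 <= f y,
      forall s, S s -> f s = 0 &
      complex.Re (f x) = infinity_bound x].
Proof.
have [F [Flin Fle Fx]] := @hahn_banach _ V _ x sublinear_infinity_bound.
have FZ (a : R) y : F (a%:C *: y) = a * F y.
  have F0 : F 0 = 0 by have := Flin (- 1) 0 0; rewrite scaler0 addr0; lra.
  by have := Flin a y 0; rewrite F0 !addr0.
have FD y z : F (y + z) = F y + F z.
  by have := Flin 1 y z; rewrite scale1r mul1r.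
have FN y : F (- y) = - F y.
  by have := FZ (-1) y; rewrite rmorphN rmorph1 scaleN1r mulN1r.
(* The properties of [F] below come from exhibiting majorants: 0 for [- y] with [y] positive, 0 for
   [s] and [- s] with [s] in [S], and 1 and -1 for the operators 1 and -1. *)
have Fb y l : majorant y l -> F y <= l.
  by move=> /infinity_bound_le; exact: le_trans (Fle y).
have Fpos y : positive_op y -> 0 <= F y.
  move=> y0; rewrite -oppr_le0 -FN; apply: Fb.
  apply: (majorant_mem S0 (@is_adjoint0 _ _)).
  by rewrite /scalar_op scale0r add0r add0r opprK.
have iRe : complex.Re ('i%R : R[i]) = 0 by rewrite -complexiE.
have iRe' : complex.Re (- 'i%R : R[i]) = 0 by rewrite -complexiE /= oppr0.
(* For self-adjoint [y] the form of ['i *: y] is purely imaginary, so 0 majorizes both ['i *: y] and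
   its opposite. This makes the complexification real on self-adjoint operators. *)
have Fi y : selfadjoint y -> F ('i *: y) = 0.
  move=> yy; have Re0 (k : R[i]) u : complex.Re k = 0 ->
      complex.Re '<(0 + scalar_op 0 - k *: y) u, u> = 0.
    move=> k0; rewrite /scalar_op scale0r !add0r bopN bopZ dotNl dotZl.
    rewrite -(RRe_real (selfadjoint_dot_real u yy)) raddfN/=.
    by case: k k0 => p q /= ->; rewrite mul0r mulr0 subr0 oppr0.
  apply/le_anti/andP; split.
    apply: Fb; exists 0; split=> // [|u]; first exact: is_adjoint0.
    by rewrite (Re0 _ _ iRe).
  rewrite -oppr_le0 -FN -scaleNr; apply: Fb; exists 0.
  split=> // [|u]; first exact: is_adjoint0.
  by rewrite (Re0 _ _ iRe').
have FS s : S s -> selfadjoint s -> F s = 0.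
  move=> Ss ss; apply/le_anti/andP; split.
    apply: Fb; apply: (majorant_mem Ss ss).
    by rewrite /scalar_op scale0r addr0 subrr; exact: positive0.
  have SN : S (- s).
    have [[_ Slin] _] := opS; have := Slin (-1) _ _ Ss S0.
    by rewrite addr0 scaleN1r.
  rewrite -oppr_le0 -FN; apply: Fb; apply: (majorant_mem SN (is_adjointN ss)).
  by rewrite /scalar_op scale0r addr0 subrr; exact: positive0.
have F1 : F 1 = 1.
  apply/le_anti/andP; split.
    apply: Fb; apply: (majorant_mem S0 (@is_adjoint0 _ _)).
    by rewrite /scalar_op scale1r add0r subrr; exact: positive0.
  rewrite -lerN2 -FN; apply: Fb; apply: (majorant_mem S0 (@is_adjoint0 _ _)).
  by rewrite /scalar_op rmorphN scaleN1r add0r opprK addNr; exact: positive0.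
pose f y : R[i] := F y +i* (- F ('i *: y)).
have fsa y : selfadjoint y -> f y = (F y)%:C.
  by move=> yy; rewrite /f Fi// oppr0.
have fD y z : f (y + z) = f y + f z.
  by rewrite /f scalerDr !FD opprD.
have i2 : 'i%R * 'i%R = -1 :> R[i] by rewrite -expr2 sqrCi.
have fZ (k : R[i]) y : f (k *: y) = k * f y.
  have kE : k = (complex.Re k)%:C + (complex.Im k)%:C * 'i%R.
    by rewrite -complexiE; case: k => p q; simpc.
  move: kE; move: (complex.Re k) (complex.Im k) => p q ->.
  have kyE : (p%:C + q%:C * 'i%R) *: y = p%:C *: y + q%:C *: ('i *: y).
    by rewrite scalerDl scalerA.
  have ikyE : 'i *: ((p%:C + q%:C * 'i%R) *: y) =
      p%:C *: ('i *: y) + (- q)%:C *: y.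
    rewrite kyE scalerDr !scalerA (mulrC _ p%:C) (mulrAC _ q%:C) i2.
    by rewrite mulN1r rmorphN.
  rewrite /f ikyE kyE !FD !FZ -complexiE.
  by simpc; congr (_ +i* _); ring.
exists f; split=> //.
- by move=> k y z _ _; rewrite fD fZ.
- by rewrite fsa ?F1.
- by move=> y y0; rewrite fsa ?lecR ?Fpos//; exact: positive_selfadjoint.
- move=> s Ss.
  have [a [b [[Sa Sb] [aa bb] _ ->]]] := cartesian_decomposition opS Ss.
  by rewrite fD fZ !fsa// !FS// mulr0 addr0.
Qed.

End Infinity.

(** * Scalar UCP maps and the representation at infinity *)

Section ScalarUcp.
Variables (R : realType) (H : hilbertType R).
Local Notation C := (complex_line R).
Implicit Types (x y : bop H) (T : set (bop H)).

Lemma bop_sum (K : hilbertType R) (I : finType) (F : I -> bop K) (v : K) :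
  (\sum_i F i) v = \sum_i F i v.
Proof. exact: (big_morph (fun x : bop K => x v)). Qed.

Lemma dot_suml (K : hilbertType R) (I : finType) (F : I -> K) (v : K) :
  '<\sum_i F i, v> = \sum_i '<F i, v>.
Proof.
by elim/big_rec2: _ => [|i y x _ <-]; rewrite ?dot0l ?dotDl.
Qed.

Lemma linear_subspace_sum T (I : finType) (F : I -> bop H) :
  linear_subspace T -> (forall i, T (F i)) -> T (\sum_i F i).
Proof.
move=> [T0 Tlin] TF; elim/big_ind: _ => // x y Tx Ty.
by rewrite -[x]scale1r; exact: Tlin.
Qed.

Lemma linear_on_sum T (f : bop H -> R[i]) (I : finType) (k : I -> R[i])
    (F : I -> bop H) : linear_subspace T -> linear_on (V := (R[i])^o) T f ->
  (forall i, T (F i)) -> f (\sum_i k i *: F i) = \sum_i k i * f (F i).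
Proof.
move=> [T0 Tlin] flin TF.
have f0 : f 0 = 0.
  have := flin 1 0 0 T0 T0; rewrite !scale1r addr0 => /eqP.
  by rewrite -subr_eq0 opprD addrA subrr sub0r oppr_eq0 => /eqP.
have [_ ->] : T (\sum_i k i *: F i) /\
    f (\sum_i k i *: F i) = \sum_i k i * f (F i) => //.
elim/big_rec2: _ => // i z x _ [Tx fx]; split; first exact: Tlin.
by rewrite flin// fx.
Qed.

(** Complete positivity is automatic for scalar values: the form of the matrix of the [f (a i j)] at
    [u] is the value of [f] at [b], and [b] is positive because its form at [v] is that of [a] at
    the vector of the [u i *: v]. *)
Lemma scalar_functional_ucp T (f : bop H -> R[i]) : linear_subspace T ->
  linear_on (V := (R[i])^o) T f -> f 1 = 1 ->
  (forall x, T x -> positive_op x -> 0 <= f x) ->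
  ucp T (fun x => scalar_op (f x) : bop C).
Proof.
move=> Tsub flin f1 fpos; split.
- by move=> k x y Tx Ty; rewrite flin// /scalar_op scalerDl scalerA.
- by rewrite f1 /scalar_op scale1r.
move=> n a Ta a0 u.
pose w i j : R[i] := (u j : R[i]) * Num.conj (u i : R[i]).
pose b := \sum_i \sum_j w i j *: a i j.
have Tb i : T (\sum_j w i j *: a i j).
  apply: linear_subspace_sum => // j; have [T0 Tlin] := Tsub.
  by rewrite -[_ *: _]addr0; exact: Tlin.
have fb : f b = \sum_i \sum_j w i j * f (a i j).
  have := @linear_on_sum T f 'I_n (fun=> 1) _ Tsub flin Tb.
  under eq_bigr do rewrite scale1r.
  rewrite /b => ->; apply: eq_bigr => i _; rewrite mul1r.
  exact: (@linear_on_sum T f _ (w i) (a i) Tsub flin (Ta i)).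
have b0 : positive_op b.
  move=> v; apply: le_trans (a0 (fun i => (u i : R[i]) *: v)) _.
  rewrite /b bop_sum dot_suml le_eqVlt; apply/orP; left; apply/eqP.
  apply: eq_bigr => i _; rewrite bop_sum !dot_suml; apply: eq_bigr => j _.
  by rewrite bopZ opZ !dotZl dotZr mulrA.
have := fpos b (linear_subspace_sum Tsub Tb) b0; rewrite fb.
move=> /le_trans; apply; rewrite le_eqVlt; apply/orP; left; apply/eqP.
apply: eq_bigr => i _; rewrite dot_suml; apply: eq_bigr => j _.
by rewrite mxE scalar_opE dotZl mulrC.
Qed.

Lemma ucp_scalar_functional T (g : bop H -> bop C) :
  ucp T g -> exists f : bop H -> R[i],
  [/\ linear_on (V := (R[i])^o) T f, f 1 = 1,
    (forall x, T x -> positive_op x -> 0 <= f x) &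
    forall x, g x = scalar_op (f x)].
Proof.
move=> [glin g1 gcp]; pose f x : R[i] := g x (1 : R[i]).
have gE x : g x = scalar_op (f x).
  apply: bop_ext => v; rewrite scalar_opE.
  have vE : v = (v : R[i]) *: (1 : (R[i])^o) :> C by rewrite [RHS]mulr1.
  rewrite {1}vE opZ; exact: (mulrC (v : R[i]) (f x)).
exists f; split=> // [k x y Tx Ty||x Tx x0].
- by rewrite /f glin.
- by rewrite /f g1.
have := gcp 1%N (const_mx x) _ _ (fun=> (1 : R[i])).
rewrite !big_ord1 !mxE gE scalar_opE dotZl => h.
pose e : C := (1 : R[i]); have -> : f x = f x * '<e, e>.
  by rewrite -[X in _ * X]/(1 * Num.conj (1 : R[i])) rmorph1 !mulr1.
apply: h => [i j|u]; first by rewrite mxE.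
by rewrite !big_ord1 !mxE.
Qed.

End ScalarUcp.

(** * The boundary property at infinity in terms of states *)

Section BoundaryAtInfinity.
Variables (R : realType) (H : hilbertType R).
Local Notation C := (complex_line R).
Implicit Types (x y : bop H).

Lemma ucp_sub (T T' : set (bop H)) (g : bop H -> bop C) :
  T `<=` T' -> ucp T' g -> ucp T g.
Proof.
move=> TT' [glin g1 gcp]; split=> // [k x y Tx Ty|n a Ta].
  by rewrite glin//; exact: TT'.
by apply: gcp => i j; exact: TT'.
Qed.

Section Character.
Variable A : set (bop H).
Hypotheses (cA : cstar_algebra A) (nuA : ~ has_unit A).

Lemma adjoin_unit_lin (k : R[i]) x y (l m : R[i]) :
  k *: (x + scalar_op l) + (y + scalar_op m) = (k *: x + y) + scalar_op (k * l + m).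
Proof. by rewrite scalerDr addrACA /scalar_op scalerA -scalerDl. Qed.

Lemma infinity_coef_linear :
  linear_on (V := (R[i])^o) (adjoin_unit A) (infinity_coef A).
Proof.
move=> k _ _ [a Aa [l ->]] [b Ab [m ->]].
by rewrite adjoin_unit_lin !infinity_coefE//; exact: cstar_lin.
Qed.

Lemma infinity_coef1 : infinity_coef A 1 = 1.
Proof.
have <- : 0 + scalar_op 1 = 1 :> bop H by rewrite add0r /scalar_op scale1r.
by rewrite infinity_coefE//; exact: cstar0.
Qed.

Lemma pi_infty_ucp : ucp (adjoin_unit A) (pi_infty A).
Proof.
apply: scalar_functional_ucp.
- by have [[]] := adjoin_unit_cstar cA nuA.
- exact: infinity_coef_linear.
- exact: infinity_coef1.
- move=> _ [a Aa [l ->]] /(infinity_coef_ge0 cA nuA Aa).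
  by rewrite infinity_coefE.
Qed.

Lemma pi_infty_multiplicative : multiplicative_on (adjoin_unit A) (pi_infty A).
Proof.
move=> _ _ [a Aa [l ->]] [b Ab [m ->]].
have -> : (a + scalar_op l) * (b + scalar_op m) =
    (a * b + m *: a + l *: b) + scalar_op (l * m).
  rewrite mulrDr !mulrDl /scalar_op !bopZr !bopZl !mulr1 mul1r.
  by rewrite scalerA (mulrC m) -!addrA; congr (_ + _); rewrite addrCA.
rewrite !pi_inftyE//; last first.
  apply: (cstarD cA); last exact: cstarZ.
  by apply: (cstarD cA); [exact: cstarM|exact: cstarZ].
by apply: bop_ext => v; rewrite bopM !scalar_opE scalerA.
Qed.

Lemma pi_infty_representation : representation (adjoin_unit A) (pi_infty A).
Proof.
split; first by have [] := pi_infty_ucp.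
  exact: pi_infty_multiplicative.
move=> _ _ [a Aa [l ->]] [b Ab [m ->]] adj.
have [c Ac ac] := cstar_adj cA Aa.
have lm : m = Num.conj l.
  have : b + scalar_op m = c + scalar_op (Num.conj l).
    apply: (is_adjoint_inj adj); apply: is_adjointD => //.
    by apply: is_adjointZ; exact: selfadjoint1.
  by move=> /(congr1 (infinity_coef A)); rewrite !infinity_coefE.
rewrite !pi_inftyE// lm; apply: is_adjointZ; exact: selfadjoint1.
Qed.

Lemma pi_infty_irreducible : irreducible_on (adjoin_unit A) (pi_infty A).
Proof.
split.
  exists 1; first exact: (adjoin_unit1 (cstar0 cA)).
  rewrite /pi_infty infinity_coef1; apply/eqP.
  move=> /(congr1 (fun f : bop C => f (1 : R[i]))).
  rewrite scalar_opE scale1r bop0; exact/eqP/oner_neq0.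
move=> M [_ M0 Mlin _]; have [[u [Mu u0]]|h] := pselect (exists u, M u /\ u <> 0).
  right; apply/seteqP; split=> // v _.
  have -> : v = ((v : R[i]) / (u : R[i])) *: u + 0.
    rewrite addr0; apply/esym; exact: (mulfVK (introN eqP u0)).
  exact: Mlin.
left; apply/seteqP; split=> [v Mv|_ ->//]; apply: contrapT => v0.
by apply: h; exists v.
Qed.

End Character.

Variable S : set (bop H).
Hypotheses (opS : operator_space S) (nuA : ~ has_unit (generated_cstar S)).
Local Notation A := (generated_cstar S).

Definition infinity_state (f : bop H -> R[i]) :=
  [/\ linear_on (V := (R[i])^o) (adjoin_unit A) f, f 1 = 1,
    forall x, adjoin_unit A x -> positive_op x -> 0 <= f x &
    forall s, S s -> f s = 0].

(** The character at infinity is always an irreducible multiplicative UCP map on the unitization, so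
    uniqueness of the extension is the only condition with content. *)
Lemma boundary_at_infinityP :
  boundary_representation (adjoin_unit S) (pi_infty A) <->
  forall f, infinity_state f -> forall x, A x -> f x = 0.
Proof.
have Sst : star_closed S by case: opS.
have S0 : S 0 by case: opS => [[]].
have cA := generated_cstarP Sst.
have SA := @sub_generated_cstar R H S.
rewrite /boundary_representation /unique_extension_property /ucp_extension.
rewrite (generated_adjoin_unit S0 Sst nuA) /infinity_state.
move: (generated_cstar S) nuA cA SA => B nuB cB SB.
have AT := @sub_adjoin_unit R H B.
have TT : adjoin_unit S `<=` adjoin_unit B.
  by move=> _ [s Ss [l ->]]; exists s; [exact: SB|exists l].
have Bsub : linear_subspace (adjoin_unit B).
  by have [[]] := adjoin_unit_cstar cB nuB.
have T1 : adjoin_unit B 1 := adjoin_unit1 (cstar0 cB).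
have piucp := pi_infty_ucp cB nuB.
have pi0 x : B x -> pi_infty B x = 0.
  move=> Bx; have := pi_inftyE 0 cB nuB Bx.
  by rewrite /scalar_op !scale0r addr0.
have split_lin f x l : linear_on (V := (R[i])^o) (adjoin_unit B) f -> f 1 = 1 ->
    B x -> f (x + scalar_op l) = f x + l.
  move=> flin f1 Bx; rewrite addrC /scalar_op flin//; last exact: AT.
  by rewrite f1 addrC; congr (_ + _); exact: mulr1.
split.
- move=> [_ _ [_ [g [[gucp gS] guniq _]]]] f [flin f1 fpos fS] x Bx.
  have fucp := scalar_functional_ucp Bsub flin f1 fpos.
  have fx : scalar_op (f x) = g x :> bop C.
    apply: (guniq (fun y => scalar_op (f y))); last exact: AT.
    split=> // _ [s Ss [l ->]].
    have Bs := SB s Ss; rewrite split_lin// fS// add0r.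
    by rewrite pi_inftyE.
  have pix : pi_infty B x = g x by apply: guniq; [|exact: AT].
  move: fx; rewrite -pix pi0// => /(congr1 (fun h : bop C => h (1 : R[i]))).
  by rewrite scalar_opE bop0 => <-; rewrite -[RHS]/(f x * 1) mulr1.
- move=> h; split.
  + exact: pi_infty_representation.
  + exact: pi_infty_irreducible.
  + split; first exact: ucp_sub TT piucp.
    exists (pi_infty B); split=> //.
      move=> g' [gucp gS] _ [a Ba [l ->]].
      have [f [flin f1 fpos fE]] := ucp_scalar_functional gucp.
      rewrite pi_inftyE// fE split_lin// (h f) ?add0r//; split=> // s Ss.
      have := gS _ (sub_adjoin_unit Ss); rewrite fE pi0; last exact: SB.
      move=> /(congr1 (fun h : bop C => h (1 : R[i]))).
      by rewrite scalar_opE bop0 => <-; rewrite -[RHS]/(f s * 1) mulr1.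
    exact: pi_infty_multiplicative.
Qed.

Lemma infinity_state_functional f : infinity_state f -> positive_functional A f.
Proof.
have AT := @sub_adjoin_unit R H A.
move=> [flin _ fpos _]; split=> [k x y Ax Ay|x Ax]; last exact/fpos/AT.
by apply: flin; exact: AT.
Qed.

Lemma infinity_state_le f x : infinity_state f -> A x ->
  almost_dominated S x -> f x <= 0.
Proof.
move=> [flin f1 fpos fS] Ax [s sP].
have cA := generated_cstarP (opS.2).
have cB := adjoin_unit_cstar cA nuA.
have fB : positive_functional (adjoin_unit A) f by [].
have B1 : adjoin_unit A 1 := adjoin_unit1 (cstar0 cA).
have AB := @sub_adjoin_unit R H A.
have SB y : S y -> adjoin_unit A y by move=> /sub_generated_cstar/AB.
move: (adjoin_unit A) fB cB B1 (AB _ Ax) SB => {AB} B fB cB B1 Bx SB.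
have key n : f x <= (n.+1%:R^-1 : R)%:C.
  have [Ss _ sx] := sP n.+1 isT; have Bs := SB _ Ss.
  have Bk := cstarZ cB (n.+1%:R^-1) B1.
  have := functional_le cB fB Bx (cstarD cB Bs Bk) sx.
  rewrite (functionalD fB)// (functionalZ cB fB)// (fS _ Ss) f1 add0r mulr1.
  by rewrite fmorphV rmorph_nat.
(* In [R[i]] a bound [f x <= r] by a real [r] already makes [f x] real. *)
have fxr : f x = (complex.Re (f x))%:C.
  rewrite RRe_real//; have := key 0%N; rewrite lecE => /andP[/eqP im _].
  by apply/complex_realP; exists (complex.Re (f x)); case: (f x) im => p q /= <-.
rewrite fxr lecR leNgt; apply/negP => f0.
have := archi_boundP (ltW (_ : 0 < (complex.Re (f x))^-1)).
rewrite invr_gt0 => /(_ f0); set n := Num.bound _ => fn.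
have := key n; rewrite fxr lecR leNgt => /negP; apply.
rewrite invf_plt ?posrE ?ltr0n//; apply: lt_trans fn _.
by rewrite ltr_nat.
Qed.

End BoundaryAtInfinity.

(** * The equivalence *)

Theorem theorem6p1 (R : realType) (H : hilbertType R) (S : set (bop H)) :
  operator_space S -> separable_set S -> ~ has_unit (generated_cstar S) ->
  let A := generated_cstar S in
  [<-> boundary_representation (adjoin_unit S) (pi_infty A);
       exists p, strictly_positive A p /\ almost_dominated S p;
       forall x, A x -> selfadjoint x -> almost_dominated S x].
Proof.
move=> opS sepS nuA A.
have Sst : star_closed S by case: opS.
have cA : cstar_algebra A := generated_cstarP Sst.
have i_iii : boundary_representation (adjoin_unit S) (pi_infty A) ->
    forall x, A x -> selfadjoint x -> almost_dominated S x.
  move=> /(boundary_at_infinityP opS nuA) h x Ax xx.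
  have [f [flin f1 fpos fS fx]] := state_extension opS nuA x.
  have fx0 : f x = 0.
    apply: h Ax; split=> // [k y z _ _|y _]; first exact: flin.
    exact: fpos.
  move: fx; rewrite fx0 /= => p0.
  have dom n : exists s, [/\ S s, selfadjoint s &
      le_op x (s + scalar_op (n.+1%:R)^-1)].
    have n0 : 0 < n.+1%:R^-1 :> R by rewrite invr_gt0.
    (* By [p0] the infimum of the majorants of [x] is 0, so one of them lies below [n.+1%:R^-1]. *)
    have [l [s [Ss ss sx]] ln] := inf_adherent n0 (has_inf_majorant opS nuA x).
    exists s; split=> // u.
    have lt0 : 0 <= n.+1%:R^-1 - l.
      rewrite subr_ge0 ltW// (lt_le_trans ln)// gerDr.
      by rewrite -[inf _]/(infinity_bound S x) -p0.
    (* Self-adjointness allows dropping the real part in [majorant]. *)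
    have sa : selfadjoint (s + scalar_op l%:C - x).
      apply: selfadjointB => //; apply: is_adjointD => //.
      exact: selfadjoint_scalar.
    have -> : s + scalar_op (n.+1%:R)^-1 - x =
        (s + scalar_op l%:C - x) + scalar_op (n.+1%:R^-1 - l)%:C.
      rewrite rmorphB fmorphV rmorph_nat /scalar_op scalerBl.
      rewrite [RHS]addrAC; congr (_ - _); rewrite -addrA; congr (_ + _).
      by rewrite addrC subrK.
    rewrite bopD dotDl addr_ge0//.
      by rewrite -(RRe_real (selfadjoint_dot_real u sa)) lecR.
    by rewrite scalar_opE dotZl mulr_ge0 ?dot_ge0// lecR.
  (* Domination is required from index 1 on, hence the shift by [n.-1]. *)
  move: dom => /choice[s sP]; exists (fun n => s n.-1) => -[//|n] _ /=.
  exact: sP.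
have iii_i : (forall x, A x -> selfadjoint x -> almost_dominated S x) ->
    boundary_representation (adjoin_unit S) (pi_infty A).
  move=> h; apply/(boundary_at_infinityP opS nuA) => f fst x Ax.
  have sa0 y : A y -> selfadjoint y -> f y = 0.
    have fpos := infinity_state_functional fst.
    move=> Ay yy; apply/le_anti.
    rewrite (infinity_state_le opS nuA fst Ay (h _ Ay yy)).
    have ANy : A (- y) by rewrite -scaleN1r; exact: (cstarZ cA _ Ay).
    have := infinity_state_le opS nuA fst ANy (h _ ANy (is_adjointN yy)).
    by rewrite -scaleN1r (functionalZ cA fpos)// mulN1r oppr_le0.
  have [opA _ _] := cA.
  have [a [b [[Aa Ab] [aa bb] _ ->]]] := cartesian_decomposition opA Ax.
  have fpos := infinity_state_functional fst.
  have Aib : A ('i *: b) by exact: (cstarZ cA _ Ab).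
  by rewrite (functionalD fpos)// (functionalZ cA fpos)// !sa0// mulr0 addr0.
have ii_i : (exists p, strictly_positive A p /\ almost_dominated S p) ->
    boundary_representation (adjoin_unit S) (pi_infty A).
  move=> [p [[Ap p0 psp] pdom]].
  apply/(boundary_at_infinityP opS nuA) => f fst x Ax.
  have fpos := infinity_state_functional fst.
  apply: psp => //; apply/le_anti.
  by rewrite (infinity_state_le opS nuA fst Ap pdom) (functional_ge0 fpos Ap p0).
have iii_ii : (forall x, A x -> selfadjoint x -> almost_dominated S x) ->
    exists p, strictly_positive A p /\ almost_dominated S p.
  move=> h; have [p psp] := strictly_positive_exists opS sepS.
  exists p; split=> //; have [Ap p0 _] := psp.
  by apply: h => //; exact: positive_selfadjoint.
by tfae; [move=> /i_iii/iii_ii|move=> /ii_i/i_iii|exact: iii_i].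
Qed.
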